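(* Let $\gamma:[a,b]\to\mathbb K\setminus\{0\}$ be a tame path with $\gamma^{-1}(\mathbb R)=\{a\le t_1<\dots<t_p\le b\}$ and with all the parameters in $\gamma^{-1}(\mathbb R)\cap(a,b)$ tame; assume that for some $k_0\in\mathbb Z$ a lift of $\gamma|_{[a,t_1]}$ to $\mathcal E_{\mathbb K}^+$ exists and equals $(\gamma(t),\operatorname{Arg}_{k_0}(\gamma(t)))$, $t\in[a,t_1]$. Let $\gamma(a)=\gamma(b)\notin\mathbb R$. Then $\sigma(\gamma)$ is even if and only if $\gamma$ is tame (as a loop) and untwisted. If this is the case, then $$\operatorname{wind}(\gamma)=|\sigma(\gamma)|/2.$$
   Context: $\mathbb K$ denotes either the algebra of quaternions or the algebra of octonions, $\operatorname{Im}(\mathbb K)$ its space of purely imaginary elements, $\mathbb S=\{I\in\mathbb K: I^2=-1\}$ and $\mathbb C_I=\mathbb R+\mathbb RI$. A path is a continuous map from a compact interval; a loop is a closed path. A companion of a path $\gamma$ is a path $\mathfrak I^\gamma:[a,b]\to\mathbb S/\{\pm\mathrm{Id}\}$ (antipodal quotient, a real projective space) with $\gamma(t)\in\mathbb C_{\mathfrak I^\gamma(t)}$ for every $t$, where $\mathbb C_{[J]}=\mathbb C_J=\mathbb C_{-J}$. A path is tame if it has a unique companion; a tame path is a tame loop if both it and its companion are closed; a tame loop is untwisted if its companion is homotopic (with fixed endpoints) to a constant in $\mathbb S/\{\pm\mathrm{Id}\}$. Let $\pm\mathcal I^\gamma$ be the two continuous lifts of $\mathfrak I^\gamma$ to $\mathbb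 S$; then $\gamma(t)=x(t)+\mathcal I^\gamma(t)y(t)$ with $x,y$ continuous real functions, and the shadows of $\gamma$ are the paths $x(t)\pm iy(t)$ in $\mathbb C\setminus\{0\}$. For an untwisted tame loop the shadows are closed, and $\operatorname{wind}(\gamma)$ is the absolute value of the usual winding number with respect to $0$ of either shadow. Write $\gamma=x+Y$ with $x$ real and $Y$ purely imaginary. A parameter $t_s\in\gamma^{-1}(\mathbb R)\cap(a,b)$ is tame if the limits $\lim_{t\to t_s^\pm}Y(t)/|Y(t)|$ both exist and are equal or opposite; it is a bounce if they are equal and a flip if they are opposite. Let $a<\xi_1<\dots<\xi_m<b$ be the flips. The signature is $\sigma(\gamma)=\sum_{l=1}^m\operatorname{sign}(\gamma(\xi_l))(-1)^l$, and $\sigma(\gamma)=0$ if there are no flips. The logarithm manifold is $\mathcal E_{\mathbb K}^+=\{(r\exp p,p): r>0,\ p\in\operatorname{Im}(\mathbb K)\}$, where $\exp(q)=\sum_{k\ge0}q^k/k!$; a lift of a path is a path in $\mathcal E_{\mathbb K}^+$ whose first component is the given path. For $q=x+Iy\in\mathbb K\setminus\mathbb R$ with $y>0$, $I\in\mathbb S$, put $\mathcal I(q)=I$, $\arg_{\mathcal I}(q)=\cot^{-1}(x/y)\in(0,\pi)$, and for $l\in\mathbb Z$: $\operatorname{Arg}_{2l}(q)=\mathcal I(q)(\arg_{\mathcal I}(q)+2l\pi)$, $\operatorname{Arg}_{2l+1}(q)=-\mathcal I(q)(2\pi-\arg_{\mathcal I}(q)+2l\pi)$. At $t_1$, $\operatorname{Arg}_{k_0}(\gamma(t_1))$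 is understood as the limit from the left. *)

(* Defs.v *)
From HB Require Import structures.
From mathcomp Require Import all_boot all_order all_algebra finmap.
From mathcomp Require Import generic_quotient complex.
From mathcomp Require Import all_classical all_reals all_analysis.

Set Implicit Arguments.
Unset Strict Implicit.
Unset Printing Implicit Defensive.

Import Order.TTheory GRing.Theory Num.Theory.
Import numFieldNormedType.Exports.

Local Open Scope classical_set_scope.
Local Open Scope ring_scope.
Local Open Scope quotient_scope.

(* The Cayley-Dickson algebras over R, with
   (a, b)(c, d) = (a c - d^* b, d a + b c^* ) and (a, b)^* = (a^*, - b):
   [cd R 2] is the algebra of quaternions and [cd R 3] that of octonions.
   The carrier is an iterated product of copies of R. Its norm as a
   [normedModType] is the sup norm, which only serves to give the usual
   topology; the Euclidean norm is [cd_norm] below. *)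
Fixpoint cd (R : realType) (n : nat) : normedModType R :=
  if n is m.+1 then (cd R m * cd R m)%type : normedModType R
  else R^o : normedModType R.

Section CayleyDickson.
Variable R : realType.

Fixpoint cd_one (n : nat) : cd R n :=
  match n with
  | 0 => (1 : R)
  | m.+1 => (cd_one m, 0)
  end.

Fixpoint cd_conj (n : nat) : cd R n -> cd R n :=
  match n with
  | 0 => fun a => a
  | m.+1 => fun p => (cd_conj p.1, - p.2)
  end.

Fixpoint cd_mul (n : nat) : cd R n -> cd R n -> cd R n :=
  match n with
  | 0 => fun a b : R => a * b
  | m.+1 => fun p q => (cd_mul p.1 q.1 - cd_mul (cd_conj q.2) p.2,
                        cd_mul q.2 p.1 + cd_mul p.2 (cd_conj q.1))
  end.

Fixpoint cd_re (n : nat) : cd R n -> R :=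
  match n with
  | 0 => fun a => a
  | m.+1 => fun p => cd_re p.1
  end.

Variable n : nat.
Local Notation K := (cd R n).
Implicit Types (q : K).

Definition cd_im q : K := q - cd_re q *: cd_one n.

Definition cd_norm q : R := Num.sqrt (cd_re (cd_mul q (cd_conj q))).

Definition is_real q : Prop := exists x : R, q = x *: cd_one n.

Definition cd_pow q (k : nat) : K := iter k (cd_mul q) (cd_one n).

Definition cd_exp q : K := limn (series (fun k => (k`!%:R)^-1 *: cd_pow q k)).

(* The sphere S of imaginary units and the plane C_I = R + R I. *)
Definition im_units : set K := [set I | cd_mul I I = - cd_one n].

Definition slice (I : K) : set K :=
  [set q | exists x y : R, q = x *: cd_one n + y *: I].

Lemma slice_opp (I : K) : slice (- I) = slice I.
Proof.
by apply/seteqP; split=> _ [x [y ->]]; exists x, (- y);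
  rewrite scalerN scaleNr ?opprK.
Qed.

(* The quotient S / {+-Id}, with the quotient of the subspace topology of S. *)
Definition antipodal : rel im_units :=
  fun I J => (val I == val J) || (val I == - val J).

Lemma antipodal_refl : reflexive antipodal.
Proof. by move=> I; rewrite /antipodal eqxx. Qed.

Lemma antipodal_sym : symmetric antipodal.
Proof.
by move=> I J; rewrite /antipodal [val J == _]eq_sym [val J == - _]eq_sym eqr_oppLR.
Qed.

Lemma antipodal_trans : transitive antipodal.
Proof.
move=> J I L; rewrite /antipodal => /orP[]/eqP-> /orP[]/eqP->;
  by rewrite ?opprK eqxx ?orbT.
Qed.

Canonical antipodal_equiv :=
  EquivRel antipodal antipodal_refl antipodal_sym antipodal_trans.

Definition proj_units : topologicalType :=
  quotient_topology {eq_quot antipodal}.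

Definition unit_class (I : im_units) : proj_units := \pi_proj_units I.

(* C_[I] = C_I = C_-I *)
Definition class_slice (c : proj_units) : set K :=
  [set q | exists I : im_units, unit_class I = c /\ slice (val I) q].

(* Paths on [a, b] are functions on R, of which only the restriction to
   [a, b] is relevant. *)
Definition is_path (T : topologicalType) (a b : R) (f : R -> T) : Prop :=
  {within `[a, b], continuous f}.

Definition companion (a b : R) (g : R -> K) (J : R -> proj_units) : Prop :=
  is_path a b J /\ forall t, t \in `[a, b] -> class_slice (J t) (g t).

Definition unique_companion (a b : R) (g : R -> K) (J : R -> proj_units) :=
  companion a b g J /\
  forall J', companion a b g J' -> forall t, t \in `[a, b] -> J' t = J t.

Definition tame_path (a b : R) (g : R -> K) : Prop :=
  is_path a b g /\ exists J, unique_companion a b g J.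

Definition tame_loop (a b : R) (g : R -> K) : Prop :=
  tame_path a b g /\ g a = g b /\
  exists J, unique_companion a b g J /\ J a = J b.

Definition path_homotopic (T : topologicalType) (a b : R) (f h : R -> T) :=
  exists H : R * R -> T,
    [/\ {within `[a, b] `*` `[0, 1], continuous H},
        forall t, t \in `[a, b] -> H (t, 0) = f t,
        forall t, t \in `[a, b] -> H (t, 1) = h t
      & forall s, s \in `[0, 1] -> H (a, s) = f a /\ H (b, s) = f b].

Definition untwisted (a b : R) (g : R -> K) : Prop :=
  tame_loop a b g /\
  exists J, unique_companion a b g J /\
    exists c, path_homotopic a b J (fun=> c).

(* The two shadows are obtained from the two continuous lifts of the
   companion to S: passing from I to -I changes y into -y. *)
Definition shadow (a b : R) (g : R -> K) (z : R -> R[i]) : Prop :=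
  exists (J : R -> proj_units) (I : R -> im_units) (x y : R -> R),
    [/\ unique_companion a b g J,
        is_path a b I /\ (forall t, t \in `[a, b] -> unit_class (I t) = J t),
        is_path a b x /\ is_path a b y,
        forall t, t \in `[a, b] -> g t = x t *: cd_one n + y t *: val (I t)
      & forall t, t \in `[a, b] -> z t = (x t +i* y t)%C].

(* m is the winding number of the closed path z around 0: z has a continuous
   argument theta, whose total variation is 2 pi m. *)
Definition winding_number (a b : R) (z : R -> R[i]) (m : int) : Prop :=
  z a = z b /\
  exists theta : R -> R,
    [/\ is_path a b theta,
        forall t, t \in `[a, b] -> exists2 r : R, 0 < r &
          z t = ((r * cos (theta t)) +i* (r * sin (theta t)))%C
      & theta b - theta a = 2 * pi * m%:~R].

(* wind(g) = w *)
Definition is_wind (a b : R) (g : R -> K) (w : R) : Prop :=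
  (exists z, shadow a b g z) /\
  forall z, shadow a b g z ->
    exists m : int, winding_number a b z m /\ w = `|m|%:~R.

(* Y / |Y|, where g = x + Y; it takes the junk value 0 where g is real. *)
Definition im_dir (g : R -> K) (t : R) : K :=
  (cd_norm (cd_im (g t)))^-1 *: cd_im (g t).

(* Requiring the one-sided limits to lie in S excludes the junk value. *)
Definition bounce (g : R -> K) (t : R) : Prop :=
  exists2 I, im_units I &
    im_dir g s @[s --> t^'-] --> I /\ im_dir g s @[s --> t^'+] --> I.

Definition flip (g : R -> K) (t : R) : Prop :=
  exists2 I, im_units I &
    im_dir g s @[s --> t^'-] --> I /\ im_dir g s @[s --> t^'+] --> - I.

Definition tame_param (g : R -> K) (t : R) : Prop := bounce g t \/ flip g t.

Definition flips (a b : R) (g : R -> K) : set R :=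
  [set t | [/\ t \in `]a, b[, is_real (g t) & flip g t]].

(* Meaningful when there are finitely many flips. The flip xi_l of the usual
   formula is the entry of index l - 1. *)
Definition signature (a b : R) (g : R -> K) : int :=
  let xi := sort <=%O (fset_set (flips a b g)) in
  \sum_(l < size xi) sgz (cd_re (g (nth 0 xi l))) * (-1) ^+ l.+1.

(* The logarithm manifold *)
Definition log_manifold : set (K * K) :=
  [set z | exists r p, [/\ 0 < r, cd_re p = 0 & z = (r *: cd_exp p, p)]].

Definition is_lift (a b : R) (g : R -> K) (G : R -> K * K) : Prop :=
  is_path a b G /\
  forall t, t \in `[a, b] -> log_manifold (G t) /\ (G t).1 = g t.

Definition acot (u : R) : R := pi / 2 - atan u.

Lemma acot_spec u :
  [/\ 0 < acot u, acot u < pi & cos (acot u) / sin (acot u) = u].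
Proof.
have h1 := atan_ltpi2 u; have h2 := atan_gtNpi2 u; rewrite /acot; split.
- by rewrite subr_gt0.
- by rewrite ltrBlDr {2}(splitr pi) -addrA ltrDl -ltrBlDl sub0r.
- by rewrite -[LHS]/(cos _ / sin _) cosB sinB cos_pihalf sin_pihalf
     !(mul0r, mul1r, add0r, subr0) -[RHS]atanK.
Qed.

Definition arg_im q : R := acot (cd_re q / cd_norm (cd_im q)).

Definition unit_im q : K := (cd_norm (cd_im q))^-1 *: cd_im q.

Definition Arg (k : int) q : K :=
  let l : R := (k %/ 2)%Z%:~R in
  if (2 %| k)%Z then (arg_im q + 2 * l * pi) *: unit_im q
  else - (2 * pi - arg_im q + 2 * l * pi) *: unit_im q.

End CayleyDickson.

(* Main.v *)
(* Writing [g = x + Y], the direction [Y / |Y|] changes its sign exactly at the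
   flips, so that [I = s Y / |Y|] extends to a continuous path of imaginary units
   when [s] is [(-1)^l] between the [l]-th flip and the next one. Its class is the
   companion of [g], and [I b = (-1)^m I a] where [m], the number of flips, has
   the parity of the signature. If [m] is even, then [I] is a loop on a sphere of
   dimension at least 2, hence it is null-homotopic; if [m] is odd, then the
   companion lifts to a path with antipodal ends, hence it is not.
   The shadow is [x + i s |Y|]. Its argument is [+-alpha] up to a locally constant
   multiple of [2 pi], where [alpha] is the angle of [x + i |Y|], in [[0, pi]]. At
   the flip of index [l] this multiple jumps by [2 (-1)^l alpha], that is by [0]
   or [2 (-1)^l pi] according to the sign of [g], and the sum of the jumps is [pi]
   times the signature. *)

Require Import Defs.
From HB Require Import structures.
From mathcomp Require Import all_boot all_order all_algebra finmap.
From mathcomp Require Import generic_quotient complex zify ring lra.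
From mathcomp Require Import all_classical all_reals all_analysis.

Set Implicit Arguments.
Unset Strict Implicit.
Unset Printing Implicit Defensive.

Import Order.TTheory GRing.Theory Num.Theory.
Import numFieldNormedType.Exports.
Local Open Scope classical_set_scope.
Local Open Scope ring_scope.
Local Open Scope quotient_scope.

(** * Euclidean geometry of the Cayley-Dickson algebras *)

Section Euclidean.
Context {R : realType}.

(** The scalar product whose norm is [cd_norm]. Metric estimates in the algebra are made on
    [dot p p] rather than on the sup norm. *)
Fixpoint dot (n : nat) : cd R n -> cd R n -> R :=
  match n with
  | 0 => fun p q : R => p * q
  | m.+1 => fun p q => dot p.1 q.1 + dot p.2 q.2
  end.

Lemma dotC n (p q : cd R n) : dot p q = dot q p.
Proof.
elim: n p q => [p q|n IH p q] /=; first by rewrite mulrC.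
by rewrite [X in X + _]IH [X in _ + X]IH.
Qed.

Lemma dotDl n (p q r : cd R n) : dot (p + q) r = dot p r + dot q r.
Proof.
elim: n p q r => [p q r|n IH p q r] /=; first by rewrite mulrDl.
by rewrite !IH addrACA.
Qed.

Lemma dotZl n c (p r : cd R n) : dot (c *: p) r = c * dot p r.
Proof.
elim: n p r => [p r|n IH p r] /=; first by rewrite mulrA.
by rewrite !IH mulrDr.
Qed.

Lemma dotDr n (p q r : cd R n) : dot r (p + q) = dot r p + dot r q.
Proof. by rewrite dotC dotDl ![dot _ r]dotC. Qed.

Lemma dotZr n c (p r : cd R n) : dot r (c *: p) = c * dot r p.
Proof. by rewrite dotC dotZl [dot _ r]dotC. Qed.

Lemma dotNl n (p r : cd R n) : dot (- p) r = - dot p r.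
Proof. by rewrite -scaleN1r dotZl mulN1r. Qed.

Lemma dotNr n (p r : cd R n) : dot r (- p) = - dot r p.
Proof. by rewrite dotC dotNl dotC. Qed.

Lemma dot0l n (r : cd R n) : dot 0 r = 0.
Proof. by rewrite -(scale0r 0) dotZl mul0r. Qed.

Lemma dot0r n (r : cd R n) : dot r 0 = 0.
Proof. by rewrite dotC dot0l. Qed.

Lemma dot_ge0 n (p : cd R n) : 0 <= dot p p.
Proof.
elim: n p => [p|n IH p] /=; first by rewrite -expr2 sqr_ge0.
exact: addr_ge0.
Qed.

Lemma dot_eq0 n (p : cd R n) : (dot p p == 0) = (p == 0).
Proof.
apply/eqP/eqP => [|->]; last exact: dot0l.
elim: n p => [p|n IH p] /=.
  by move/eqP; rewrite mulf_eq0 orbb => /eqP.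
move/eqP; rewrite paddr_eq0 ?dot_ge0// => /andP[/eqP/IH p1 /eqP/IH p2].
by rewrite [p]surjective_pairing p1 p2.
Qed.

(** By the parallelogram identity the two sides differ by |p - q|^2. This serves as a triangle
    inequality for squared norms. *)
Lemma dot_sqr_add_le n (p q : cd R n) :
  dot (p + q) (p + q) <= 2 * dot p p + 2 * dot q q.
Proof.
rewrite -subr_ge0; suff -> : 2 * dot p p + 2 * dot q q - dot (p + q) (p + q)
  = dot (p - q) (p - q) by exact: dot_ge0.
rewrite !(dotDl, dotDr, dotNl, dotNr) (dotC q p); ring.
Qed.

(** Convexity of the squared norm: the defect is t (1 - t) |p - q|^2. *)
Lemma dot_sqr_conv_le n (t : R) (p q : cd R n) : 0 <= t <= 1 ->
  dot ((1 - t) *: p + t *: q) ((1 - t) *: p + t *: q)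
  <= (1 - t) * dot p p + t * dot q q.
Proof.
move=> /andP[t0 t1]; rewrite -subr_ge0.
suff -> : (1 - t) * dot p p + t * dot q q
    - dot ((1 - t) *: p + t *: q) ((1 - t) *: p + t *: q)
  = t * (1 - t) * dot (p - q) (p - q).
  by rewrite mulr_ge0 ?dot_ge0// mulr_ge0// subr_ge0.
rewrite !(dotDl, dotDr, dotNl, dotNr, dotZl, dotZr) (dotC q p); ring.
Qed.

Lemma cvg_dot n (T : Type) (F : set_system T) {FF : Filter F}
    (f h : T -> cd R n) (p q : cd R n) :
  f @ F --> p -> h @ F --> q -> dot (f t) (h t) @[t --> F] --> dot p q.
Proof.
elim: n f h p q => [|n IH] f h p q fp hq /=; first exact: cvgM.
by apply: cvgD; apply: IH;
  [apply: cvg_comp fp _|apply: cvg_comp hq _|apply: cvg_comp fp _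
  |apply: cvg_comp hq _]; (exact: cvg_fst || exact: cvg_snd).
Qed.

Lemma continuous_dot n (T : topologicalType) (f h : T -> cd R n) :
  continuous f -> continuous h -> continuous (fun t => dot (f t) (h t)).
Proof. by move=> fc hc t; apply: cvg_dot; [exact: fc|exact: hc]. Qed.

End Euclidean.

(** * Conjugation, real and imaginary parts, imaginary units *)

Section CayleyDicksonTheory.
Context {R : realType} {n : nat}.
Implicit Types p q : cd R n.

Lemma cd_conjD m (p q : cd R m) : cd_conj (p + q) = cd_conj p + cd_conj q.
Proof. by elim: m p q => [//|m IH p q] /=; rewrite IH opprD. Qed.

Lemma cd_conjN m (p : cd R m) : cd_conj (- p) = - cd_conj p.
Proof. by elim: m p => [//|m IH p] /=; rewrite IH. Qed.

Lemma cd_conjK m (p : cd R m) : cd_conj (cd_conj p) = p.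
Proof.
by elim: m p => [//|m IH p] /=; rewrite IH opprK -surjective_pairing.
Qed.

Lemma cd_conj1 m : cd_conj (cd_one R m) = cd_one R m.
Proof. by elim: m => [//|m /= ->]; rewrite oppr0. Qed.

Lemma cd_mulD m : 
  (forall p q r : cd R m, cd_mul (p + q) r = cd_mul p r + cd_mul q r) /\
  (forall p q r : cd R m, cd_mul r (p + q) = cd_mul r p + cd_mul r q).
Proof.
elim: m => [|m [IHl IHr]].
  by split=> p q r /=; rewrite (mulrDl, mulrDr).
split=> p q r /=.
  by rewrite !(IHl, IHr) opprD addrACA; congr (_, _); rewrite addrACA.
by rewrite !(cd_conjD, IHl, IHr) opprD addrACA; congr (_, _); rewrite addrACA.
Qed.

Lemma cd_mul0l m (q : cd R m) : cd_mul 0 q = 0.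
Proof. by apply: (addrI (cd_mul 0 q)); rewrite -(cd_mulD m).1 !addr0. Qed.

Lemma cd_mul0r m (q : cd R m) : cd_mul q 0 = 0.
Proof. by apply: (addrI (cd_mul q 0)); rewrite -(cd_mulD m).2 !addr0. Qed.

Lemma cd_mulNl m (p q : cd R m) : cd_mul (- p) q = - cd_mul p q.
Proof. by apply/eqP; rewrite -addr_eq0 -(cd_mulD m).1 addNr cd_mul0l. Qed.

Lemma cd_mulNr m (p q : cd R m) : cd_mul p (- q) = - cd_mul p q.
Proof. by apply/eqP; rewrite -addr_eq0 -(cd_mulD m).2 addNr cd_mul0r. Qed.

(** With p = (a, b), the first coordinate of p p^* is a a^* + b^* b, so both orders of the factors
    go through one induction; the second coordinates cancel. *)
Lemma cd_mul_conj m (p : cd R m) :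
  cd_mul p (cd_conj p) = dot p p *: cd_one R m /\
  cd_mul (cd_conj p) p = dot p p *: cd_one R m.
Proof.
elim: m p => [p|m IH p] /=; first by split; rewrite /GRing.scale /= mulr1.
have [h1 h2] := IH p.1; have [h3 h4] := IH p.2.
rewrite cd_conjN !cd_mulNl !cd_mulNr !opprK h1 h2 h4 cd_conjK.
by split; rewrite (addNr, subrr) -scalerDl -[(0 : cd R m) in LHS](scaler0 _ (dot p p)).
Qed.

Lemma cd_re1 m : cd_re (cd_one R m) = 1.
Proof. by elim: m. Qed.

Lemma dot_one m (p : cd R m) : dot p (cd_one R m) = cd_re p.
Proof.
by elim: m p => [p|m IH p] /=; [rewrite mulr1|rewrite IH dot0r addr0].
Qed.

Lemma cd_add_conj m (p : cd R m) : p + cd_conj p = (2 * cd_re p) *: cd_one R m.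
Proof.
elim: m p => [p|m IH p] /=.
  by rewrite /GRing.scale /= mulr1 mulr_natl mulr2n.
rewrite [LHS]surjective_pairing /= IH subrr [RHS]surjective_pairing /=.
by rewrite scaler0.
Qed.

Lemma cd_mulr1 m (p : cd R m) : cd_mul p (cd_one R m) = p.
Proof.
elim: m p => [p|m IH p] /=; first by rewrite mulr1.
rewrite cd_conj1 !IH cd_mul0l.
have -> : cd_conj (0 : cd R m) = 0 by rewrite -(subrr (cd_one R m)) cd_conjD cd_conjN cd_conj1 subrr.
by rewrite cd_mul0l subr0 add0r -surjective_pairing.
Qed.

Lemma cd_reZ (c : R) p : cd_re (c *: p) = c * cd_re p.
Proof. by rewrite -!dot_one dotZl. Qed.

Lemma cd_reD p q : cd_re (p + q) = cd_re p + cd_re q.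
Proof. by rewrite -!dot_one dotDl. Qed.

Lemma cd_reN p : cd_re (- p) = - cd_re p.
Proof. by rewrite -!dot_one dotNl. Qed.

Lemma dot_one_one : dot (cd_one R n) (cd_one R n) = 1.
Proof. by rewrite dot_one cd_re1. Qed.

Lemma cd_conjZ m c (p : cd R m) : cd_conj (c *: p) = c *: cd_conj p.
Proof. by elim: m p => [//|m IH p] /=; rewrite IH -scalerN. Qed.

Lemma cd_mulZ m c :
  (forall p q : cd R m, cd_mul (c *: p) q = c *: cd_mul p q) /\
  (forall p q : cd R m, cd_mul p (c *: q) = c *: cd_mul p q).
Proof.
elim: m => [|m [IHl IHr]].
  by split=> p q; [exact: esym (mulrA c p q)|exact: (mulrCA p c q)].
by split=> p q /=; rewrite !(cd_conjZ, IHl, IHr) -scalerN -!scalerDr.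
Qed.

(** The quadratic equation of p, obtained by writing the second factor as 2 Re p - p^*. *)
Lemma cd_mul_self p :
  cd_mul p p = (2 * cd_re p) *: p - dot p p *: cd_one R n.
Proof.
have -> : cd_mul p p = cd_mul p ((2 * cd_re p) *: cd_one R n - cd_conj p).
  by rewrite -cd_add_conj addrK.
by rewrite (cd_mulD n).2 cd_mulNr (cd_mul_conj p).1 (cd_mulZ n _).2 cd_mulr1.
Qed.

(** By the quadratic equation, p^2 = -1 with Re p nonzero would make p a real multiple of 1, whose
    square cannot be -1. Thus S is the unit sphere of the imaginary space. *)
Lemma im_unitsP p : im_units p <-> cd_re p = 0 /\ dot p p = 1.
Proof.
rewrite /im_units /= cd_mul_self; split=> [pE|[-> ->]]; last first.
  by rewrite mulr0 scale0r scale1r add0r.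
have re2 : 2 * cd_re p * cd_re p - dot p p = -1.
  by have /(congr1 (@cd_re R n)) := pE; rewrite cd_reD !cd_reN !cd_reZ cd_re1 mulr1.
suff p0 : cd_re p = 0 by split=> //; move: re2; rewrite p0; lra.
apply/eqP/negPn/negP => p_neq0.
have pc : p = ((2 * cd_re p)^-1 * (dot p p - 1)) *: cd_one R n.
  rewrite -scalerA scalerBl scale1r -pE addrCA subrr addr0.
  by rewrite scalerK// mulf_neq0.
have /(congr1 (@cd_re R n)) := pc; rewrite cd_reZ cd_re1 mulr1 => rE.
have := dot_one_one; move: re2; rewrite [in dot p p]pc -rE dotZl dotZr dot_one_one => ? _.
have := sqr_ge0 (cd_re p); rewrite expr2; lra.
Qed.

Lemma cd_normE p : cd_norm p = Num.sqrt (dot p p).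
Proof. by rewrite /cd_norm (cd_mul_conj p).1 cd_reZ cd_re1 mulr1. Qed.

Lemma cd_norm_sqr p : cd_norm p ^+ 2 = dot p p.
Proof. by rewrite cd_normE sqr_sqrtr// dot_ge0. Qed.

Lemma cd_norm_eq0 p : (cd_norm p == 0) = (p == 0).
Proof. by rewrite -sqrf_eq0 cd_norm_sqr dot_eq0. Qed.

Lemma cd_norm_gt0 p : (0 < cd_norm p) = (p != 0).
Proof. by rewrite lt0r cd_norm_eq0 cd_normE sqrtr_ge0 andbT. Qed.

Lemma cd_re_im p : cd_re (cd_im p) = 0.
Proof. by rewrite cd_reD cd_reN cd_reZ cd_re1 mulr1 subrr. Qed.

Lemma cd_decomp p : p = cd_re p *: cd_one R n + cd_im p.
Proof. by rewrite addrC subrK. Qed.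

Lemma is_realP p : is_real p <-> cd_im p = 0.
Proof.
split=> [[x ->]|p0]; last by exists (cd_re p); rewrite {1}[p]cd_decomp p0 addr0.
by rewrite /cd_im cd_reZ cd_re1 mulr1 subrr.
Qed.

Lemma dot_decomp p : dot p p = cd_re p ^+ 2 + cd_norm (cd_im p) ^+ 2.
Proof.
rewrite cd_norm_sqr {1 2}[p]cd_decomp; have := cd_re_im p.
move: (cd_im p) => y; rewrite -dot_one => y0.
by rewrite !(dotDl, dotDr, dotZl, dotZr) dot_one_one [dot (cd_one R n) y]dotC y0; ring.
Qed.

Lemma unit_im_units p : cd_im p != 0 -> im_units (unit_im p).
Proof.
move=> p0; have p1 : cd_norm (cd_im p) != 0 by rewrite cd_norm_eq0.
apply/im_unitsP; rewrite /unit_im cd_reZ cd_re_im mulr0 dotZl dotZr -cd_norm_sqr.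
by split=> //; field.
Qed.

Lemma cd_im_polar p : cd_im p = cd_norm (cd_im p) *: unit_im p.
Proof.
rewrite /unit_im scalerA; have [->|p0] := eqVneq (cd_im p) 0.
  by rewrite scaler0.
by rewrite divff ?scale1r// cd_norm_eq0.
Qed.

Lemma im_unitsN p : im_units p -> im_units (- p).
Proof.
by move=> /im_unitsP[p0 p1]; apply/im_unitsP; rewrite cd_reN p0 oppr0 dotNl dotNr opprK.
Qed.

Lemma im_units_normalize p : cd_re p = 0 -> p != 0 ->
  im_units ((cd_norm p)^-1 *: p).
Proof.
move=> pr p0; have p1 : cd_norm p != 0 by rewrite cd_norm_eq0.
apply/im_unitsP; rewrite cd_reZ pr mulr0 dotZl dotZr -cd_norm_sqr.
by split=> //; field.
Qed.

Lemma continuous_cd_re : continuous (@cd_re R n).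
Proof.
have -> : @cd_re R n = (fun p => dot p (cd_one R n)).
  by apply/funext => p; rewrite dot_one.
by apply: continuous_dot => p; [exact: cvg_id|exact: cvg_cst].
Qed.

Lemma continuous_cd_im : continuous (@cd_im R n).
Proof.
move=> p; apply: cvgB; first exact: cvg_id.
by apply: cvgZ; [exact: continuous_cd_re|exact: cvg_cst].
Qed.

Lemma continuous_cd_norm : continuous (@cd_norm R n).
Proof.
have -> : @cd_norm R n = (fun p => Num.sqrt (dot p p)).
  by apply/funext => p; rewrite cd_normE.
move=> p; apply: (@continuous_comp _ _ _ (fun p => dot p p) Num.sqrt).
  by apply: continuous_dot => q; exact: cvg_id.
exact: sqrt_continuous.
Qed.

Lemma dot_unit_close p q : im_units p -> im_units q ->
  dot (p - q) (p - q) = 2 - 2 * dot p q.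
Proof.
move=> /im_unitsP[_ p1] /im_unitsP[_ q1].
by rewrite !(dotDl, dotDr, dotNl, dotNr) p1 q1 (dotC q p); ring.
Qed.

End CayleyDicksonTheory.

(** * Compactness: Lebesgue numbers *)

Lemma lebesgue_number {R : realType} {T : pseudoMetricType R} (C : set T)
    (Q : T -> T -> Prop) :
  compact C ->
  (forall x, C x -> \forall y \near x, C y -> Q x y) ->
  exists2 d : R, 0 < d & forall y, C y ->
    exists2 x, C x & forall z, C z -> ball y d z -> Q x z.
Proof.
move=> /compact_near_coveringP/near_covering_withinP cC CQ.
(* In its near-covering form, compactness makes a choice of [d] that works locally work on all of
   [C]. *)
have : \forall d \near (0 : R)^'+, C `<=` fun y =>
    exists2 x, C x & forall z, C z -> ball y d z -> Q x z.
  (* If y is within e / 2 of x and d < e / 2, then the ball of radius d around y lies in the ball of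
     radius e around x. *)
  apply: cC => x Cx; have [e /= e0 xQ] := (nbhs_ballP _ _).1 (CQ x Cx).
  exists (ball x (e / 2), [set d | d < e / 2]) => /=.
    by split; [apply: nbhsx_ballx; rewrite divr_gt0|apply: nbhs_right_lt; rewrite divr_gt0].
  move=> [y d] /= [xy dlt] Cy; exists x => // z Cz yz.
  by apply: xQ => //; apply: ball_splitr (ball_sym xy) _ => //; apply: le_ball yz; exact: ltW.
move=> CF; have [d [d0 dC]] : exists d : R, 0 < d /\ C `<=` fun y =>
    exists2 x, C x & forall z, C z -> ball y d z -> Q x z.
  by near ((0 : R)^'+) => d; exists d; split; [near: d; exact: nbhs_right_gt|near: d].
by exists d.
Unshelve. all: by end_near. Qed.

(** * Continuous functions on an interval *)

Section RealLine.
Context {R : realType}.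
Implicit Types a b t : R.

(** The retraction of the line onto [a, b]: composing with it extends a path to a function
    continuous on the whole line. *)
Definition clamp a b t : R := Order.max a (Order.min b t).

Lemma clamp_itv a b t : a <= b -> clamp a b t \in `[a, b].
Proof. by move=> ab; rewrite in_itv /= /clamp le_max lexx ge_max ab ge_min lexx. Qed.

Lemma clamp_id a b t : t \in `[a, b] -> clamp a b t = t.
Proof. by rewrite in_itv /= => /andP[at_ tb]; rewrite /clamp min_r// max_r. Qed.

Lemma continuous_clamp a b : continuous (clamp a b).
Proof.
move=> t; apply: (@continuous_max _ _ (fun=> a) (fun u => Order.min b u)).
  exact: cvg_cst.
by apply: (@continuous_min _ _ (fun=> b) id); [exact: cvg_cst|exact: cvg_id].
Qed.

Lemma continuous_comp_clamp (T : topologicalType) a b (f : R -> T) : a <= b ->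
  is_path a b f -> continuous (f \o clamp a b).
Proof.
move=> ab fc t; have ct := clamp_itv t ab.
have := (subspace_continuousP _ _).1 fc (clamp a b t) ct; apply: cvg_comp.
move=> U [e /= e0 eU].
have := @continuous_clamp a b t _ (nbhsx_ballx (clamp a b t) e e0).
move=> ctu; change (\forall u \near t, U (clamp a b u)); near=> u.
apply: eU; [by near: u|exact: clamp_itv].
Unshelve. all: by end_near.
Qed.

Lemma continuous_is_path (T : topologicalType) a b (f : R -> T) :
  continuous f -> is_path a b f.
Proof. by move=> fc; exact: continuous_subspaceT. Qed.

(** As the inverse of [cos] on the segment [0, pi], [acos] is continuous up to the ends of [-1, 1].
    These ends are the values met where a path is real. *)
Lemma continuous_acos_clamp : continuous (fun x : R => acos (clamp (-1) 1 x)).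
Proof.
apply: continuous_comp_clamp; first by rewrite (le_trans _ ler01)// lerN10.
have := @segment_can_ge_continuous R 0 pi cos (@acos R) (pi_ge0 R).
by rewrite cos0 cospi; apply; [exact/continuous_subspaceT/continuous_cos|exact: cosK].
Qed.

(** A change of sign would produce a zero by the intermediate value theorem. This gives that two
    continuous lifts to S of one companion differ by a global sign. *)
Lemma sign_constant a b (f : R -> R) : a <= b -> is_path a b f ->
  (forall t, t \in `[a, b] -> f t = 1 \/ f t = -1) ->
  {in `[a, b], forall t, f t = f a}.
Proof.
move=> ab fc f1 t tab.
have aab : a \in `[a, b] by rewrite in_itv /= lexx.
have [at_ tb] : a <= t /\ t <= b by move: tab; rewrite in_itv /= => /andP.
have f_neq0 x : a <= x <= t -> f x != 0.
  move=> /andP[ax xt]; have : x \in `[a, b] by rewrite in_itv /= ax (le_trans xt).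
  by move/f1 => [->|->]; rewrite ?oppr_eq0 oner_neq0.
have fact : {within `[a, t], continuous f}.
  by apply: continuous_subspaceW fc; apply: subset_itvl; rewrite bnd_simp.
have ivt : Num.min (f a) (f t) <= 0 <= Num.max (f a) (f t) -> False.
  move=> h; have [c cat fc0] := IVT at_ fact h.
  by move: (f_neq0 c cat); rewrite fc0 eqxx.
have [fa|fa] := f1 _ aab; have [ft|ft] := f1 _ tab; rewrite fa ft //; exfalso; apply: ivt.
  by rewrite fa ft ge_min le_max ler01 lerN10 orbT.
by rewrite fa ft ge_min le_max ler01 lerN10 orbT.
Qed.

End RealLine.

Lemma uniform_dot {R : realType} {n : nat} (a b : R) (f : R -> cd R n) (e : R) :
  continuous f -> 0 < e ->
  exists2 d : R, 0 < d & forall t u, t \in `[a, b] -> u \in `[a, b] ->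
    `|t - u| < d -> dot (f t - f u) (f t - f u) < e.
Proof.
(* Both values are within e / 4, in squared norm, of a common f x, and 2 (e / 4) + 2 (e / 4) = e. *)
move=> fc e0; have e4 : 0 < e / 4 by rewrite divr_gt0.
have [|d d0 dP] := lebesgue_number
    (Q := fun x y => dot (f x - f y) (f x - f y) < e / 4) (@segment_compact R a b).
  move=> x _; have : (fun y => dot (f x - f y) (f x - f y)) y @[y --> x] -->
      dot (f x - f x) (f x - f x).
    by apply: cvg_dot; (apply: cvgB; [exact: cvg_cst|exact: fc]).
  rewrite subrr dot0l => /cvgr_lt/(_ _ e4); apply: filterS => y ? _; assumption.
exists d => // t u tab uab tu; have [x _ xP] := dP t tab.
have xt := xP t tab (ballxx _ d0); have xu := xP u uab tu.
have -> : f t - f u = - (f x - f t) + (f x - f u) by rewrite opprB addrA subrK.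
by apply: le_lt_trans (dot_sqr_add_le _ _) _; rewrite dotNl dotNr opprK; lra.
Qed.

(** * Piecewise linear curves *)

Section PiecewiseLinear.
Context {R : realType} {n : nat}.
Implicit Types (v : nat -> cd R n) (N : nat) (x : R).

(** The polygonal curve with vertex [v k] at x = k: the summand of index k is 0 before k, then grows
    linearly and stays at [v k.+1 - v k] after k + 1. Continuity is immediate in this form. *)
Definition pl v N x : cd R n :=
  v 0 + \sum_(k < N) clamp 0 1 (x - k%:R) *: (v k.+1 - v k).

(** On [j, j + 1] the summands before j are saturated and telescope to [v j - v 0], and those after
    j vanish. *)
Lemma pl_segment v N j x : (j < N)%N -> j%:R <= x <= j.+1%:R ->
  pl v N x = (1 - (x - j%:R)) *: v j + (x - j%:R) *: v j.+1.
Proof.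
move=> jN /andP[jx xj].
have plS : pl v j.+1 x = (1 - (x - j%:R)) *: v j + (x - j%:R) *: v j.+1.
  rewrite /pl big_ord_recr /= (eq_bigr (fun k : 'I_j => v k.+1 - v k)).
    rewrite -(big_mkord xpredT (fun k => v k.+1 - v k)) telescope_sumr// addrA.
    have : x - j%:R \in `[0, 1].
      by rewrite in_itv /= subr_ge0 jx /= lerBlDl natr1.
    move: (x - j%:R) => c c01; rewrite [v 0 + _]addrC subrK clamp_id//.
    by rewrite scalerBr scalerBl scale1r addrCA addrC.
  move=> k _; have kj : k.+1%:R <= x by apply: le_trans jx; rewrite ler_nat.
  rewrite /clamp min_l ?max_r ?ler01 ?scale1r//.
  by rewrite lerBrDl natr1.
rewrite -plS /pl -(subnKC jN) big_split_ord /= [X in _ + (_ + X)]big1 ?addr0//.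
move=> k _; rewrite /clamp; have kx : x - (j.+1 + k)%:R <= 0.
  by rewrite subr_le0 (le_trans xj)// ler_nat leq_addr.
by rewrite min_r ?max_l// ?scale0r// (le_trans kx).
Qed.

Lemma continuous_pl v N : continuous (pl v N).
Proof.
move=> x; apply: cvgD; first exact: cvg_cst.
apply: cvg_big => [|k _]; first exact: add_continuous.
apply: cvgZ; last exact: cvg_cst.
apply: (@continuous_comp _ _ _ (fun x => x - k%:R) (clamp 0 1)).
  by apply: cvgB; [exact: cvg_id|exact: cvg_cst].
exact: continuous_clamp.
Qed.

End PiecewiseLinear.

(** * Subdivisions, and contraction of loops on the sphere of imaginary units *)

Lemma nat_segment {R : realType} (N : nat) (x : R) : (0 < N)%N ->
  0 <= x <= N%:R -> exists2 j, (j < N)%N & j%:R <= x <= j.+1%:R.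
Proof.
case: N => // N _; elim: N => [|N IH] /andP[x0 xN]; first by exists 0; rewrite ?x0.
have [xN1|xN1] := leP x N.+1%:R; last by exists N.+1; rewrite ?(ltW xN1).
by have [|j jN jx] := IH; [rewrite x0|exists j => //; exact: ltnW].
Qed.

Lemma exists_mesh {R : realType} (a b d : R) : a < b -> 0 < d ->
  exists (N : nat) (h : R), [/\ 0 < h, h < d & a + N%:R * h = b].
Proof.
move=> ab d0; have ba0 : 0 < b - a by rewrite subr_gt0.
pose N := (Num.bound ((b - a) / d)).+1.
have N0 : 0 < N%:R :> R by rewrite ltr0n.
exists N, ((b - a) / N%:R); split.
- exact: divr_gt0.
- rewrite ltr_pdivrMr// mulrC -ltr_pdivrMr//.
  apply: lt_trans (archi_boundP _) _; first by rewrite divr_ge0 ?ltW.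
  by rewrite ltr_nat.
- by rewrite mulrC divfK ?gt_eqF// addrC subrK.
Qed.

(** The imaginary space has dimension at least 3, so some z lies outside of the span of u and w. If
    q lies in that span, adding a small multiple of z moves it out. *)
Lemma exists_generic_point {R : realType} {n : nat} (hn : n = 2%N \/ n = 3%N)
    (e : R) (u w q : cd R n) : 0 < e -> cd_re q = 0 ->
  exists v, [/\ cd_re v = 0, dot (v - q) (v - q) < e &
    forall x y : R, v != x *: u + y *: w].
Proof.
move=> e0 q0.
(* Three orthonormal imaginary vectors: the quaternions i, j, k, embedded as pairs with second entry
   0 in the octonions. *)
have [f [f_re f_dot]] : exists f : 'I_3 -> cd R n, (forall i, cd_re (f i) = 0) /\
    (forall i j, dot (f i) (f j) = (i == j)%:R).
  have [f [f_re f_dot]] : exists f : 'I_3 -> cd R 2, (forall i, cd_re (f i) = 0) /\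
      (forall i j, dot (f i) (f j) = (i == j)%:R).
    exists (fun i : 'I_3 => (((0 : R), (val i == 0)%:R : R),
                             ((val i == 1)%:R : R, (val i == 2)%:R : R)) : cd R 2).
    split=> //.
    by do 2 case=> [[|[|[|?]]]//= ?]; rewrite !(mulr0, mul0r, mulr1, addr0, add0r).
  case: hn => ->; first by exists f.
  exists (fun i => (f i, 0) : cd R 3); split => // i j.
  by rewrite -f_dot -[LHS]/(dot (f i) (f j) + dot (0 : cd R 2) 0) dot0l addr0.
have [z [z0 zP]] : exists z, cd_re z = 0 /\ forall x y : R, z != x *: u + y *: w.
  apply: contrapT => noz.
  have /choice[c fE] : forall i, exists c : R * R, f i = c.1 *: u + c.2 *: w.
    move=> i; apply: contrapT => fiP; apply: noz; exists (f i); split=> // x y.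
    by apply/eqP => fi; apply: fiP; exists (x, y).
  (* If u and w spanned all three vectors, their Gram matrix, the identity of size 3, would factor
     through dimension 2. *)
  pose M := \matrix_(i < 3, j < 2) if j == 0 then (c i).1 else (c i).2.
  pose P := \matrix_(i < 2, j < 3) if i == 0 then dot u (f j) else dot w (f j).
  have /mulmx1_min // : M *m P = 1%:M.
  apply/matrixP => i j; rewrite !mxE !big_ord_recl big_ord0 !mxE /= addr0.
  by rewrite -f_dot (fE i) dotDl !dotZl.
have [qP|] := pselect (forall x y : R, q != x *: u + y *: w).
  by exists q; split=> //; rewrite subrr dot0l.
move=> /existsNP[x /existsNP[y /negP/negPn/eqP qE]].
(* So chosen that |d z|^2 = e |z|^2 / (|z|^2 + 1) < e. *)
pose d := Num.sqrt (e / (dot z z + 1)).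
have z1 : 0 < dot z z + 1 by rewrite ltr_pwDr ?dot_ge0.
have d0 : 0 < d by rewrite sqrtr_gt0 divr_gt0.
exists (q + d *: z); split.
- by rewrite cd_reD cd_reZ q0 z0 mulr0 addr0.
- rewrite addrC addKr dotZl dotZr mulrA -expr2 sqr_sqrtr ?divr_ge0 ?ltW//.
  by rewrite -mulrA gtr_pMr// mulrC ltr_pdivrMr// mul1r ltrDl.
- move=> x' y'; apply/eqP => /(congr1 (fun v => d^-1 *: (v - q))).
  rewrite addrC addKr scalerA mulVf ?gt_eqF// scale1r => zE.
  have /eqP := zP (d^-1 * (x' - x)) (d^-1 * (y' - y)); apply.
  rewrite zE qE -!scalerA -scalerDr !scalerBl; congr (_ *: _).
  by rewrite opprD addrACA.
Qed.

(* The closeness of [L] to [f] and its avoidance of the ray opposite to [f a]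
   let straight segments deform [f] to [L] and [L] to [f a] away from [0]. The
   avoidance is obtained by choosing each vertex outside of the plane spanned by
   the previous one and [f a]. *)
Lemma exists_pl_approx {R : realType} {n : nat} (hn : n = 2%N \/ n = 3%N)
    (a b : R) (f : R -> cd R n) : a < b -> continuous f ->
  (forall t, im_units (f t)) -> f a = f b ->
  exists L : R -> cd R n, [/\ continuous L, L a = f a, L b = f a,
    forall t, cd_re (L t) = 0 &
    forall t, t \in `[a, b] -> dot (L t - f t) (L t - f t) < 1 /\
      forall c : R, 0 <= c -> L t != - c *: f a].
Proof.
move=> ab fc fS fab; pose e := f a.
have [e_re e1] := (im_unitsP e).1 (fS a).
have e_neq0 : e != 0 by rewrite -dot_eq0 e1 oner_neq0.
(* Vertices and oscillation of f are each controlled by 1 / 4, since 2 (1 / 4) + 2 (1 / 4) = 1. *)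
have [d d0 dP] := uniform_dot a b fc (divr_gt0 ltr01 (ltr0n R 4)).
have [N [h [h0 hd NE]]] := exists_mesh ab d0.
have N0 : (0 < N)%N by case: N NE => // NE; move: ab; rewrite -NE mul0r addr0 ltxx.
pose T (k : nat) := a + k%:R * h.
have T0 : T 0 = a by rewrite /T mul0r addr0.
have TN : T N = b by exact: NE.
have Tab k : (k <= N)%N -> T k \in `[a, b].
  move=> kN; rewrite in_itv /= -TN; apply/andP; split.
    by rewrite lerDl mulr_ge0// ltW.
  by rewrite lerD2l ler_pM2r// ler_nat.
have /choice[G GP] : forall uq : cd R n * cd R n, exists v, cd_re uq.2 = 0 ->
    [/\ cd_re v = 0, dot (v - uq.2) (v - uq.2) < 1 / 4 &
     forall x y : R, v != x *: uq.1 + y *: e].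
  move=> [u q]; have [q0|q0] := pselect (cd_re q = 0); last by exists 0.
  have [v vP] := exists_generic_point hn u e (divr_gt0 ltr01 (ltr0n R 4)) q0.
  by exists v.
pose v := fix v k := if k is k'.+1 then G (v k', f (T k'.+1)) else e.
have f_re t : cd_re (f t) = 0 by have [] := (im_unitsP _).1 (fS t).
(* The last vertex is reset to [e] so that the polygon closes; being f b, it is still close to f. *)
pose w k := if (k < N)%N then v k else e.
have vP k : [/\ cd_re (v k.+1) = 0,
    dot (v k.+1 - f (T k.+1)) (v k.+1 - f (T k.+1)) < 1 / 4 &
    forall x y : R, v k.+1 != x *: v k + y *: e].
  exact: (GP (v k, f (T k.+1)) (f_re _)).
have w_re k : cd_re (w k) = 0.
  by rewrite /w; case: ifP => // _; case: k => [//|k]; have [] := vP k.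
have w_close k : (k <= N)%N -> dot (w k - f (T k)) (w k - f (T k)) < 1 / 4.
  rewrite /w leq_eqVlt => /predU1P[->|kN].
    by rewrite ltnn TN -fab subrr dot0l divr_gt0.
  rewrite kN; case: k {kN} => [|k]; last by have [] := vP k.
  by rewrite T0 subrr dot0l divr_gt0.
have w_ray k (c : R) : 0 <= c -> w k != - c *: e.
  move=> c0; have e_ray : e != - c *: e.
    rewrite -subr_eq0 -{1}[e]scale1r -scalerBl scaler_eq0 negb_or e_neq0 andbT.
    by rewrite opprK gt_eqF// ltr_wpDr.
  rewrite /w; case: ifP => // _; case: k => [//|k]; have [_ _ /(_ 0 (- c))] := vP k.
  by rewrite scale0r add0r.
have xab t : t \in `[a, b] -> 0 <= (t - a) / h <= N%:R.
  rewrite in_itv /= => /andP[at_ tb].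
  rewrite divr_ge0 ?subr_ge0 ?(ltW h0)//= ler_pdivrMr//.
  by rewrite lerBlDl NE.
have w0 : w 0 = e by rewrite /w N0.
have wN : w N = e by rewrite /w ltnn.
exists (fun t => pl w N ((t - a) / h)); split.
- move=> t; apply: (@continuous_comp _ _ _ (fun t => (t - a) / h) (pl w N)).
    by apply: cvgM; [apply: cvgB; [exact: cvg_id|exact: cvg_cst]|exact: cvg_cst].
  exact: continuous_pl.
- rewrite subrr mul0r (pl_segment w (N := N) (j := 0))// ?lexx ?ler01//.
  by rewrite subrr subr0 scale1r scale0r addr0.
- have -> : (b - a) / h = N%:R by rewrite -NE addrC addKr mulfK// gt_eqF.
  have jN : (N.-1 < N)%N by rewrite prednK.
  have seg : N.-1%:R <= (N%:R : R) <= N.-1.+1%:R.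
    by rewrite (prednK N0) !ler_nat leq_pred leqnn.
  rewrite (pl_segment w jN seg).
  have -> : N%:R - N.-1%:R = 1 :> R.
    by rewrite -{1}(prednK N0) -natr1 addrAC subrr add0r.
  by rewrite prednK// subrr scale0r scale1r add0r.
- move=> t; rewrite /pl cd_reD w0 e_re add0r.
  rewrite -dot_one; elim/big_ind: _ => [|x y x0 y0|k _]; first by rewrite dot0l.
    by rewrite dotDl x0 y0 addr0.
  by rewrite dotZl dot_one cd_reD cd_reN !w_re subrr mulr0.
move=> t tab; have [j jN /[dup] jx /andP[jx1 jx2]] := nat_segment N0 (xab t tab).
rewrite (pl_segment w jN jx).
have s01 : 0 <= (t - a) / h - j%:R <= 1 by rewrite subr_ge0 jx1 lerBlDl natr1.
have tj : t = T j + ((t - a) / h - j%:R) * h.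
  by rewrite /T mulrBl divfK ?gt_eqF//; ring.
move: s01 tj; move: (_ - j%:R) => s /[dup] s01 /andP[s0 s1] tj.
have t_close k : (k <= N)%N -> `|T k - t| < d -> dot (w k - f t) (w k - f t) < 1.
  move=> kN kt; have -> : w k - f t = (w k - f (T k)) + (f (T k) - f t).
    by rewrite addrA subrK.
  apply: le_lt_trans (dot_sqr_add_le _ _) _.
  have := w_close k kN; have := dP _ _ (Tab _ kN) tab kt; lra.
have c0 : dot (w j - f t) (w j - f t) < 1.
  apply: t_close; first exact: ltnW.
  have sh0 : 0 <= s * h by apply: mulr_ge0 => //; exact: ltW.
  rewrite tj opprD addrA subrr add0r normrN ger0_norm//.
  by apply: le_lt_trans hd; rewrite ler_piMl ?(ltW h0).
have c1 : dot (w j.+1 - f t) (w j.+1 - f t) < 1.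
  apply: t_close => //.
  have -> : T j.+1 - t = (1 - s) * h by rewrite tj /T -natr1; ring.
  have sh0 : 0 <= (1 - s) * h by apply: mulr_ge0; [rewrite subr_ge0|exact: ltW].
  rewrite ger0_norm//.
  by apply: le_lt_trans hd; rewrite ler_piMl ?(ltW h0)// gerBl.
(* Closeness passes from the two vertices to the segment by convexity; strictness comes from the
   second vertex unless s = 0. *)
split.
  have -> : (1 - s) *: w j + s *: w j.+1 - f t =
      (1 - s) *: (w j - f t) + s *: (w j.+1 - f t).
    by rewrite !scalerBr addrACA -opprD -scalerDl subrK scale1r.
  apply: le_lt_trans (dot_sqr_conv_le _ _ s01) _.
  have [->|s_neq0] := eqVneq s 0; first by rewrite subr0 mul1r mul0r addr0.
  have s_gt0 : 0 < s by rewrite lt0r s_neq0.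
  have : s * dot (w j.+1 - f t) (w j.+1 - f t) < s by rewrite gtr_pMr.
  have : (1 - s) * dot (w j - f t) (w j - f t) <= 1 - s.
    by rewrite ler_piMr ?subr_ge0// ltW.
  lra.
move=> c c_ge0; apply/eqP => wE.
have [s_eq0|s_neq0] := eqVneq s 0.
  by have := w_ray j c c_ge0; rewrite -wE s_eq0 subr0 scale1r scale0r addr0 eqxx.
have [s_eq1|s_neq1] := eqVneq s 1.
  by have := w_ray j.+1 c c_ge0; rewrite -wE s_eq1 subrr scale1r scale0r add0r eqxx.
(* A point of the opposite ray inside the segment puts [w j.+1] in the plane of [w j] and [e],
   against the choice of the vertices before the last one. *)
have wS : w j.+1 = - (s^-1 * (1 - s)) *: w j + - (s^-1 * c) *: e.
  have /(congr1 (fun p => s^-1 *: (p - (1 - s) *: w j))) := wE.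
  rewrite addrC addKr scalerA mulVf// scale1r => ->.
  by rewrite scalerBr !scalerA addrC mulrN !scaleNr.
have [jN1|jN1] := ltnP j.+1 N.
  have [_ _ /(_ (- (s^-1 * (1 - s))) (- (s^-1 * c)))] := vP j.
  by move: wS; rewrite /w jN1 jN => ->; rewrite eqxx.
(* On the last segment the end is [e], and then [w j] itself would lie on the opposite ray. *)
have wj : w j.+1 = e by rewrite /w ltnNge jN1.
have wjE : w j = - ((s + c) / (1 - s)) *: e.
  have s1' : 1 - s != 0 by rewrite subr_eq0 eq_sym.
  have /(congr1 (fun p => (1 - s)^-1 *: (p - s *: w j.+1))) := wE.
  rewrite addrK scalerA mulVf// scale1r => ->; rewrite wj.
  by rewrite -scalerBl scalerA; congr (_ *: _); field.
have q0 : 0 <= (s + c) / (1 - s) by apply: divr_ge0; [exact: addr_ge0|rewrite subr_ge0].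
by have := w_ray j _ q0; rewrite wjE eqxx.
Qed.

(** Two straight homotopies, from f to the polygon L and from L to the point f a, are run one after
    the other and projected radially to the sphere. *)
Lemma sphere_loop_nullhomotopic {R : realType} {n : nat}
    (hn : n = 2%N \/ n = 3%N) (a b : R) (f : R -> cd R n) :
  a < b -> continuous f -> (forall t, im_units (f t)) -> f a = f b ->
  exists H : R * R -> cd R n, [/\ continuous H, forall p, im_units (H p),
    forall t, t \in `[a, b] -> H (t, 0) = f t,
    forall t, H (t, 1) = f a &
    forall s, H (a, s) = f a /\ H (b, s) = f a].
Proof.
move=> ab fc fS fab.
have [L [Lc La Lb L_re LP]] := exists_pl_approx hn ab fc fS fab.
have aab : a \in `[a, b] by rewrite in_itv /= lexx ltW.
have bab : b \in `[a, b] by rewrite in_itv /= lexx ltW.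
(* [u] runs from 0 to 1 in the first half of the time and [w] in the second half. *)
pose u (s : R) := clamp 0 1 (2 * s).
pose w (s : R) := clamp 0 1 (2 * s - 1).
pose h (p : R * R) : cd R n := let t := clamp a b p.1 in
  (1 - w p.2) *: ((1 - u p.2) *: f t + u p.2 *: L t) + w p.2 *: f a.
have f_re t : cd_re (f t) = 0 by have [] := (im_unitsP _).1 (fS t).
have f1 t : dot (f t) (f t) = 1 by have [] := (im_unitsP _).1 (fS t).
have f_neq0 t : f t != 0 by rewrite -dot_eq0 f1 oner_neq0.
have h_re p : cd_re (h p) = 0.
  by rewrite /h !(cd_reD, cd_reZ) !f_re L_re; ring.
have h_neq0 p : h p != 0.
  rewrite /h /=; have := clamp_itv p.1 (ltW ab); move: (clamp a b p.1) => t tab.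
  have [Lf Lray] := LP t tab.
  have [s2|s2] := leP (2 * p.2) 1.
    have -> : w p.2 = 0.
      by rewrite /w /clamp min_r ?max_l ?subr_le0// (le_trans _ ler01)// subr_le0.
    rewrite subr0 scale1r scale0r addr0.
    have : u p.2 \in `[0, 1] by rewrite clamp_itv.
    rewrite in_itv /=; move: (u p.2) => v /andP[v0 v1]; apply/eqP => E.
    (* A zero in the first half would give |f t| <= |L t - f t| < 1. In the second half it would put
       L t on the ray opposite to f a. *)
    have : f t = - v *: (L t - f t).
      rewrite -[f t in LHS]subr0 -E scalerBl scale1r scaleNr scalerBr.
      by rewrite opprD opprB addrA [f t + _]addrC subrK opprB.
    move=> /(congr1 (fun q => dot q q)); rewrite f1 dotZl dotZr mulrA mulrNN.
    move=> E1; have : v * v * dot (L t - f t) (L t - f t) < 1.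
      apply: le_lt_trans Lf; rewrite ler_piMl ?dot_ge0// mulr_ile1//.
    by rewrite -E1 ltxx.
  have -> : u p.2 = 1 by rewrite /u /clamp min_l ?max_r ?ler01// ltW.
  rewrite subrr scale0r add0r scale1r.
  have : w p.2 \in `[0, 1] by rewrite clamp_itv.
  rewrite in_itv /=; move: (w p.2) => v /andP[v0 v1].
  have [->|v_neq1] := eqVneq v 1; first by rewrite subrr scale0r add0r scale1r.
  have v' : 0 < 1 - v by rewrite subr_gt0 lt_neqAle v_neq1.
  apply/eqP => /(congr1 (fun q => (1 - v)^-1 *: (q - v *: f a))).
  rewrite addrK scalerA mulVf ?gt_eqF// scale1r add0r scalerN scalerA -scaleNr => E.
  have q0 : 0 <= (1 - v)^-1 * v by rewrite mulr_ge0// invr_ge0 ltW.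
  by have := Lray _ q0; rewrite E eqxx.
have uc : continuous u.
  move=> s; apply: (@continuous_comp _ _ _ (fun s : R => 2 * s) (clamp 0 1)).
    by apply: cvgM; [exact: cvg_cst|exact: cvg_id].
  exact: continuous_clamp.
have wc : continuous w.
  move=> s; apply: (@continuous_comp _ _ _ (fun s : R => 2 * s - 1) (clamp 0 1)).
    by apply: cvgB; [apply: cvgM; [exact: cvg_cst|exact: cvg_id]|exact: cvg_cst].
  exact: continuous_clamp.
have tc (T : topologicalType) (k : R -> T) : continuous k ->
    continuous (fun p : R * R => k (clamp a b p.1)).
  move=> kc p; apply: (@continuous_comp _ _ _ fst (k \o clamp a b)); first exact: cvg_fst.
  by apply: continuous_comp; [exact: continuous_clamp|exact: kc].
have sc (k : R -> R) : continuous k -> continuous (fun p : R * R => k p.2).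
  by move=> kc p; apply: (@continuous_comp _ _ _ snd k); [exact: cvg_snd|exact: kc].
have hc : continuous h.
  move=> p; apply: cvgD; apply: cvgZ; [|apply: cvgD; apply: cvgZ| |exact: cvg_cst].
  - by apply: cvgB; [exact: cvg_cst|exact: sc].
  - by apply: cvgB; [exact: cvg_cst|exact: sc].
  - exact: tc.
  - exact: sc.
  - exact: tc.
  - exact: sc.
have fN t : (cd_norm (f t))^-1 *: f t = f t.
  by rewrite cd_normE f1 sqrtr1 invr1 scale1r.
exists (fun p => (cd_norm (h p))^-1 *: h p); split.
- move=> p; apply: cvgZ; last exact: hc.
  apply: cvgV; first by rewrite cd_norm_eq0.
  by apply: (@continuous_comp _ _ _ h (@cd_norm R n)); [exact: hc|exact: continuous_cd_norm].
- by move=> p; exact: im_units_normalize.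
- move=> t tab; have -> : h (t, 0) = f t; last exact: fN.
  rewrite /h /= clamp_id// /u /w mulr0 sub0r.
  have -> : clamp 0 1 (-1) = 0 :> R by rewrite /clamp min_r ?max_l ?lerN10// lerN10.
  by rewrite clamp_id ?in_itv /= ?lexx ?ler01// subr0 !scale0r !scale1r !addr0.
- move=> t; have -> : h (t, 1) = f a; last exact: fN.
  rewrite /h /= /w mulr1.
  have -> : clamp 0 1 (2 - 1) = 1 :> R.
    have -> : 2 - 1 = 1 :> R by lra.
    by rewrite clamp_id// in_itv /= ler01 lexx.
  by rewrite subrr scale0r add0r scale1r.
- have conv (v : R) (q : cd R n) : (1 - v) *: q + v *: q = q.
    by rewrite -scalerDl subrK scale1r.
  have he t s : t \in `[a, b] -> f t = f a -> L t = f a -> h (t, s) = f a.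
    by move=> tab ft Lt; rewrite /h /= clamp_id// ft Lt !conv.
  by move=> s; rewrite !he ?fN.
Qed.

(** * The double cover of the projective space by the sphere *)

Section DoubleCover.
Context {R : realType} {n : nat}.
Implicit Types p q e : cd R n.

(** The bound 7 / 8 means |p - e|^2 < 1 / 4, and likewise for q, so that |p - q|^2 < 1, whereas p.q
    <= 0 would give at least 2. *)
Lemma dot_close_gt0 p q e : im_units p -> im_units q -> im_units e ->
  7 / 8 < dot p e -> 7 / 8 < dot q e -> 0 < dot p q.
Proof.
move=> pS qS eS pe qe.
have := dot_sqr_add_le (p - e) (- (q - e)).
have -> : (p - e) + - (q - e) = p - q by rewrite opprB addrA subrK.
rewrite dotNl dotNr opprK !dot_unit_close//; lra.
Qed.

(** Since 49 / 64 = (7 / 8)^2, the hypotheses only see p and q up to sign; changing their signs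
    reduces to the case where both are close to e. *)
Lemma sg_dot_close p q e : im_units p -> im_units q -> im_units e ->
  49 / 64 < dot p e ^+ 2 -> 49 / 64 < dot q e ^+ 2 ->
  Num.sg (dot p q) = Num.sg (dot p e) * Num.sg (dot q e).
Proof.
move=> pS qS eS.
have sgE (x : R) : 49 / 64 < x ^+ 2 -> 7 / 8 < x \/ 7 / 8 < - x.
  move=> x2; have [x0|x0] := leP 0 x; [left|right]; nra.
have pNS := im_unitsN pS; have qNS := im_unitsN qS.
move=> /sgE[] pe /sgE[] qe; move: (pe) (qe); rewrite -?dotNl => pe' qe'.
- have := dot_close_gt0 pS qS eS pe' qe' => pq.
  by rewrite !gtr0_sg ?mulr1 ?(lt_trans _ pe) ?(lt_trans _ qe).
- have := dot_close_gt0 pS qNS eS pe' qe'; rewrite dotNr oppr_gt0 => pq.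
  rewrite (ltr0_sg pq) (gtr0_sg (lt_trans _ pe)) ?(ltr0_sg (x := dot q e)) ?mul1r//.
  by rewrite -oppr_gt0 (lt_trans _ qe).
- have := dot_close_gt0 pNS qS eS pe' qe'; rewrite dotNl oppr_gt0 => pq.
  rewrite (ltr0_sg pq) (gtr0_sg (lt_trans _ qe)) ?(ltr0_sg (x := dot p e)) ?mulr1//.
  by rewrite -oppr_gt0 (lt_trans _ pe).
- have := dot_close_gt0 pNS qNS eS pe' qe'; rewrite dotNl dotNr opprK => pq.
  rewrite (gtr0_sg pq) !ltr0_sg ?mulrNN ?mulr1//.
    by rewrite -oppr_gt0 (lt_trans _ qe).
  by rewrite -oppr_gt0 (lt_trans _ pe).
Qed.

Lemma unit_classE (I J : @im_units R n) :
  unit_class I = unit_class J <-> val I = val J \/ val I = - val J.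
Proof.
have IJP := eqmodP (@antipodal_equiv R n) I J.
split=> [/(introT IJP) /orP[]/eqP|IJ]; [by left|by right|].
by apply: (elimT IJP); case: IJ => IJ; rewrite /= /antipodal IJ eqxx ?orbT.
Qed.

Lemma im_units_val (I : @im_units R n) : im_units (val I).
Proof. exact: set_mem (valP I). Qed.

Lemma continuous_im_units_val : continuous (val : @im_units R n -> cd R n).
Proof. exact: (@initial_continuous _ _ (@set_val _ (@im_units R n))). Qed.

(** The choice [repr] need not be continuous, but the square does not see the sign, so it descends
    to the quotient. *)
Lemma continuous_dot_repr e :
  continuous (fun c : proj_units R n => dot (val (repr c)) e ^+ 2).
Proof.
apply: (@repr_comp_continuous _ _ _ (fun I : @im_units R n => dot (val I) e ^+ 2)).
  move=> I; apply: (@continuous_comp _ _ _ (val : @im_units R n -> _) (fun p => dot p e ^+ 2)).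
    exact: continuous_im_units_val.
  apply: (@continuous_comp _ _ _ (fun p => dot p e) (fun x => x ^+ 2)).
    by apply: cvg_dot; [exact: cvg_id|exact: cvg_cst].
  exact: exprn_continuous.
move=> I J /eqP /unit_classE[->//|->].
by rewrite dotNl sqrrN.
Qed.

(* Along a grid, the product of the signs of the scalar products of
   representatives of consecutive points does not depend on the choice of the
   representatives, and it is the same on both sides of a small cell. *)
Lemma antipodal_path_not_nullhomotopic (a b : R) (f : R -> cd R n)
    (I : R -> @im_units R n) (c : proj_units R n) :
  a < b -> continuous f -> (forall t, val (I t) = f t) -> f b = - f a ->
  ~ path_homotopic a b (fun t => unit_class (I t)) (fun=> c).
Proof.
move=> ab fc If fba [H [Hc H0 H1 Hab]].
have fS t : im_units (f t) by rewrite -If; exact: im_units_val.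
pose r (z : R * R) := val (repr (H z)).
have rS z : im_units (r z) by exact: im_units_val.
pose C := `[a, b]%classic `*` `[(0 : R), 1]%classic.
have Ccompact : compact C by apply: compact_setX; exact: segment_compact.
have rr z : dot (r z) (r z) = 1 by have [] := (im_unitsP _).1 (rS z).
have [|d d0 dP] := lebesgue_number
    (Q := fun p q : R * R => 49 / 64 < dot (r q) (r p) ^+ 2) Ccompact.
  move=> /= z Cz; have := (subspace_continuousP _ _).1 Hc z Cz => Hz.
  have := cvg_comp _ _ Hz (@continuous_dot_repr (r z) (H z)).
  have lt1 : 49 / 64 < dot (r z) (r z) ^+ 2 by rewrite rr expr1n; lra.
  by move=> /cvgr_gt/(_ _ lt1); rewrite near_withinE.
(* For unit vectors, |f t - f u|^2 < 2 says that f t and f u have positive scalar product. *)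
have [d' d'0 d'P] := uniform_dot a b fc (ltr0n R 2).
have dd0 : 0 < Num.min d d' by rewrite lt_min d0.
have [N [h [h0 hd NE]]] := exists_mesh ab dd0.
have [M [k [k0 kd ME]]] := exists_mesh (@ltr01 R) d0.
move: hd; rewrite lt_min => /andP[hd hd'].
pose T i := a + i%:R * h; pose S j := 0 + j%:R * k.
have Tab i : (i <= N)%N -> T i \in `[a, b].
  move=> iN; rewrite in_itv /= -NE; apply/andP; split.
    by rewrite lerDl mulr_ge0// ltW.
  by rewrite lerD2l ler_pM2r// ler_nat.
have S01 j : (j <= M)%N -> S j \in `[0, 1].
  move=> jM; rewrite in_itv /= -ME; apply/andP; split.
    by rewrite lerDl mulr_ge0// ltW.
  by rewrite lerD2l ler_pM2r// ler_nat.
pose P i j := (T i, S j).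
pose sh i j := Num.sg (dot (r (P i j)) (r (P i.+1 j))).
pose sv i j := Num.sg (dot (r (P i j)) (r (P i j.+1))).
(* All four corners are close, up to sign, to one [r p]. Each edge sign is then the product of the
   signs of its two ends relative to [r p]. *)
have cell i j : (i < N)%N -> (j < M)%N -> sh i j * sv i.+1 j = sv i j * sh i j.+1.
  move=> iN jM; have CP i' j' : (i' <= N)%N -> (j' <= M)%N -> C (P i' j').
    by move=> iN' jM'; split; [exact: Tab|exact: S01].
  have [p Cp pP] := dP (P i j) (CP _ _ (ltnW iN) (ltnW jM)).
  have TS : ball (T i) d (T i.+1).
    rewrite /ball /= /T -natr1 mulrDl mul1r addrA opprD addrA subrr add0r normrN.
    by rewrite gtr0_norm.
  have SS : ball (S j) d (S j.+1).
    rewrite /ball /= /S -natr1 mulrDl mul1r addrA opprD addrA subrr add0r normrN.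
    by rewrite gtr0_norm.
  have q00 := pP _ (CP _ _ (ltnW iN) (ltnW jM)) (ballxx _ d0).
  have q10 := pP _ (CP i.+1 j iN (ltnW jM)) (conj TS (ballxx _ d0)).
  have q01 := pP _ (CP i j.+1 (ltnW iN) jM) (conj (ballxx _ d0) SS).
  have q11 := pP _ (CP i.+1 j.+1 iN jM) (conj TS SS).
  have sgE y z : 49 / 64 < dot (r y) (r p) ^+ 2 -> 49 / 64 < dot (r z) (r p) ^+ 2 ->
    _ := sg_dot_close (rS y) (rS z) (rS p).
  rewrite /sh /sv (sgE _ _ q00 q10) (sgE _ _ q10 q11) (sgE _ _ q00 q01) (sgE _ _ q01 q11).
  have sg2 (q : R * R) : 49 / 64 < dot (r q) (r p) ^+ 2 ->
      Num.sg (dot (r q) (r p)) * Num.sg (dot (r q) (r p)) = 1.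
    move=> q2; rewrite -expr2 sqr_sg; case: eqP q2 => //= ->; rewrite expr0n /=; lra.
  have mulC4 (x y z w : R) : y * y = 1 -> z * z = 1 -> x * y * (y * w) = x * z * (z * w).
    by move=> yy zz; rewrite -!mulrA (mulrA y y) (mulrA z z) yy zz !mul1r.
  by apply: mulC4; exact: sg2.
have side i j : r (P i j) = r (P i j.+1) -> sv i j = 1.
  by rewrite /sv => <-; rewrite rr sgr1.
have rE (y z : R * R) : H y = H z -> r y = r z by rewrite /r => ->.
(* The homotopy fixes the ends, so consecutive points of a vertical side have the same class and
   hence the same representative. *)
have sv0 j : (j < M)%N -> sv 0 j = 1.
  move=> jM; apply/side/rE; rewrite /P /T mul0r addr0.
  by rewrite (Hab _ (S01 _ (ltnW jM))).1 (Hab _ (S01 _ jM)).1.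
have svN j : (j < M)%N -> sv N j = 1.
  move=> jM; apply/side/rE; rewrite /P /T NE.
  by rewrite (Hab _ (S01 _ (ltnW jM))).2 (Hab _ (S01 _ jM)).2.
pose row j := \prod_(i < N) sh i j.
have rowS j : (j < M)%N -> row j = row j.+1.
  move=> jM; rewrite -[LHS]mulr1 -(svN j jM) -[RHS]mul1r -(sv0 j jM).
  rewrite /row; suff : forall m, (m <= N)%N ->
     (\prod_(i < m) sh i j) * sv m j = sv 0 j * \prod_(i < m) sh i j.+1 by exact.
  elim=> [|m IH mN]; first by rewrite !big_ord0 mulr1 mul1r.
  by rewrite !big_ord_recr /= -mulrA cell// mulrA IH ?mulrA// ltnW.
have rowM : row M = 1.
  rewrite /row big1// => i _; rewrite /sh (_ : r (P i.+1 M) = r (P i M)) ?rr ?sgr1//.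
  by apply: rE; rewrite /P /S ME !H1 ?Tab// ltnW.
have row0M : row 0 = row M.
  suff : forall m, (m <= M)%N -> row 0 = row m by exact.
  by elim=> [//|m IH mM]; exact: etrans (IH (ltnW mM)) (rowS _ mM).
(* The sign relating the representative on the bottom row to the lift f. The product of the row
   telescopes to [tau 0 * tau N], which is -1 because f b = - f a, while the constant top row gives
   1. *)
pose tau i := dot (r (P i 0)) (f (T i)).
have HP0 i : (i <= N)%N -> unit_class (repr (H (P i 0))) = unit_class (I (T i)).
  by move=> iN; rewrite /P /S mul0r addr0 H0 ?Tab//= /unit_class reprK.
have tauE i : (i <= N)%N -> r (P i 0) = tau i *: f (T i) /\ tau i ^+ 2 = 1.
  have f1 t : dot (f t) (f t) = 1 by have [] := (im_unitsP _).1 (fS t).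
  move=> iN; rewrite /tau; have /unit_classE := HP0 i iN; rewrite -/(r _) If => -[] ->.
    by rewrite f1 scale1r expr1n.
  by rewrite dotNl f1 scaleN1r sqrrN expr1n.
have shE i : (i < N)%N -> sh i 0 = tau i * tau i.+1.
  move=> iN; have [ri ti] := tauE i (ltnW iN); have [rj tj] := tauE i.+1 iN.
  rewrite /sh ri rj dotZl dotZr.
  have fij : 0 < dot (f (T i)) (f (T i.+1)).
    have := d'P _ _ (Tab _ (ltnW iN)) (Tab _ iN).
    rewrite dot_unit_close//.
    have -> : `|T i - T i.+1| = h.
      rewrite /T -natr1 mulrDl mul1r addrA opprD addrA subrr add0r normrN.
      by rewrite gtr0_norm.
    by move=> /(_ hd'); lra.
  rewrite !sgrM (gtr0_sg fij) mulr1.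
  have sgt x : x ^+ 2 = 1 -> Num.sg x = x :> R.
    by move/eqP; rewrite sqrf_eq1 => /orP[]/eqP->; rewrite ?sgrN sgr1.
  by rewrite !sgt.
have rowtau m : (m <= N)%N -> \prod_(i < m) sh i 0 = tau 0 * tau m.
  elim: m => [_|m IH mN].
    by rewrite big_ord0 -expr2 (tauE 0 isT).2.
  rewrite big_ord_recr /= IH ?(ltnW mN)// shE// mulrA -[_ * tau m * tau m]mulrA.
  by rewrite -expr2 (tauE m (ltnW mN)).2 mulr1.
have tauN : tau N = - tau 0.
  have T0 : T 0 = a by rewrite /T mul0r addr0.
  rewrite /tau -dotNr T0 -fba /T NE; congr dot; apply: rE.
  rewrite /P /S mul0r addr0 T0 /T NE !H0 ?in_itv /= ?lexx ?ltW//.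
  by apply/unit_classE; right; rewrite !If fba.
move: (row0M); rewrite rowM /row rowtau// tauN mulrN -expr2 (tauE 0 isT).2.
lra.
Qed.

End DoubleCover.

(** * Counting the flips before a parameter, and its one-sided limits *)

Section SignChanges.
Context {R : realType}.
Implicit Types (F : seq R) (t x : R).

Local Notation count_lt F t := (count (fun y : R => y < t) F).
Local Notation count_le F t := (count (fun y : R => y <= t) F).

Lemma near_left_ltE y t : \forall x \near t^'-, (y < x) = (y < t).
Proof.
have [yt|ty] := ltP y t; first exact: nbhs_left_gt.
by near=> x; apply/negbTE; rewrite -leNgt (le_trans _ ty)//.
Unshelve. all: by end_near. Qed.

Lemma near_right_ltE y t : \forall x \near t^'+, (y < x) = (y <= t).
Proof.
have [yt|ty] := leP y t.
  by near=> x; apply: le_lt_trans yt _; near: x; exact: nbhs_right_gt.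
by near=> x; apply/negbTE; rewrite -leNgt; near: x; exact: nbhs_right_le.
Unshelve. all: by end_near. Qed.

Lemma near_left_count F t : \forall x \near t^'-, count_lt F x = count_lt F t.
Proof.
elim: F => [|y F IH]; first exact: nearW.
near=> x => /=; congr (nat_of_bool _ + _)%N; near: x; last exact: IH.
exact: near_left_ltE.
Unshelve. all: by end_near. Qed.

Lemma near_right_count F t : \forall x \near t^'+, count_lt F x = count_le F t.
Proof.
elim: F => [|y F IH]; first exact: nearW.
near=> x => /=; congr (nat_of_bool _ + _)%N; near: x; last exact: IH.
exact: near_right_ltE.
Unshelve. all: by end_near. Qed.

Lemma near_left_notin F t : \forall x \near t^'-, x \notin F.
Proof.
elim: F => [|y F IH]; first exact: nearW.
near=> x; rewrite inE negb_or; apply/andP; split; near: x; last exact: IH.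
have [yt|ty] := ltP y t.
  by near=> x; rewrite gt_eqF//; near: x; exact: nbhs_left_gt.
by near=> x; rewrite lt_eqF// (lt_le_trans _ ty).
Unshelve. all: by end_near. Qed.

Lemma near_right_notin F t : \forall x \near t^'+, x \notin F.
Proof.
elim: F => [|y F IH]; first exact: nearW.
near=> x; rewrite inE negb_or; apply/andP; split; near: x; last exact: IH.
have [ty|yt] := ltP t y.
  by near=> x; rewrite lt_eqF//; near: x; exact: nbhs_right_lt.
by near=> x; rewrite gt_eqF// (le_lt_trans yt).
Unshelve. all: by end_near. Qed.

Lemma count_lt_none F t : (forall x, x \in F -> t <= x) -> count_lt F t = 0%N.
Proof.
move=> Ft; apply/eqP; rewrite -leqn0 leqNgt -has_count; apply/hasPn => x /Ft.
by rewrite leNgt.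
Qed.

Lemma count_lt_all F t : (forall x, x \in F -> x < t) -> count_lt F t = size F.
Proof. by move=> Ft; apply/eqP; rewrite -all_count; apply/allP. Qed.

(** The count jumps by one exactly at an entry, and its value just before the jump is the index of
    that entry. This ties the sign on each side of a flip to the position of the flip in the
    signature. *)
Lemma count_le_sorted F t : sorted <%R F ->
  count_le F t = (count_lt F t + (t \in F))%N /\
  (t \in F -> nth 0 F (count_lt F t) = t).
Proof.
move=> Fs; have [tF|tF] := boolP (t \in F); last first.
  split=> //; rewrite addn0; apply: eq_in_count => y yF.
  by rewrite le_eqVlt; case: eqP yF tF => // -> ->.
have iF : (index t F < size F)%N by rewrite index_mem.
have lt_i := count_lt_nth 0 Fs iF; have le_i := count_le_nth 0 Fs iF.
rewrite !nth_index// in lt_i le_i.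
by rewrite [count_lt F t]lt_i [count_le F t]le_i addn1 nth_index.
Qed.

Lemma sign_mul_self k : (-1) ^+ k * (-1) ^+ k = 1 :> R.
Proof. by rewrite -exprMn mulrNN mulr1 expr1n. Qed.

End SignChanges.

(** * Continuous lift of the companion and continuous argument of the shadow *)

Section Lifts.
Context {R : realType} {n : nat}.
Variables (G : R -> cd R n) (ts F : seq R).
Hypothesis Gc : continuous G.
Hypothesis G_neq0 : forall t, G t != 0.
Hypothesis tsP : forall t, is_real (G t) <-> t \in ts.
Hypothesis ts_tame : forall t, t \in ts -> tame_param G t.
Hypothesis F_sorted : sorted <%R F.
Hypothesis F_flip : forall t, t \in F <-> t \in ts /\ flip G t.

(** The count is strict, so [s] is left-continuous: at a flip it keeps its value from before the
    flip. *)
Let N t := count (fun y : R => y < t) F.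
Let s t : R := (-1) ^+ N t.

Lemma im_dir_cvg t : t \notin ts -> im_dir G x @[x --> t] --> im_dir G t.
Proof.
move=> tts; have Yc : (fun x => cd_im (G x)) x @[x --> t] --> cd_im (G t).
  by apply: (@continuous_comp _ _ _ G (@cd_im R n)); [exact: Gc|exact: continuous_cd_im].
apply: cvgZ => //; apply: cvgV.
  by rewrite cd_norm_eq0; apply/eqP => /is_realP/tsP; exact/negP.
exact: (@continuous_comp _ _ _ (fun x => cd_im (G x)) (@cd_norm R n)) Yc (@continuous_cd_norm _ _ _).
Qed.

(** The direction Y / |Y| is completed at the real points by its left limit; the right limit is then
    the same up to a sign that is -1 exactly at the flips. *)
Lemma exists_direction : exists U : R -> cd R n, [/\
  forall t, im_units (U t), forall t, t \notin ts -> U t = im_dir G t,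
  forall t, im_dir G x @[x --> t^'-] --> U t &
  forall t, im_dir G x @[x --> t^'+] --> (-1) ^+ (t \in F) *: U t].
Proof.
suff /choice[U UP] : forall t, exists u, [/\ im_units u, t \notin ts -> u = im_dir G t,
  im_dir G x @[x --> t^'-] --> u &
  im_dir G x @[x --> t^'+] --> (-1) ^+ (t \in F) *: u].
  by exists U; split=> t; have [] := UP t.
move=> t; have [tts|tts] := boolP (t \in ts).
  have [tF|tF] := boolP (t \in F).
    have [_ [u uS [ul ur]]] := (F_flip t).1 tF.
    by exists u; split=> //; rewrite expr1 scaleN1r.
  have [[u uS [ul ur]]|tflip] := ts_tame tts.
    by exists u; split=> //; rewrite expr0 scale1r.
  by move/negP: tF; case; apply/F_flip.
have tF : t \notin F by apply: contra tts => /F_flip[].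
have Ut := im_dir_cvg tts.
exists (im_dir G t); split => //.
- apply: unit_im_units; apply/eqP => /is_realP/tsP; exact/negP.
- exact: cvg_at_left_filter.
- by rewrite (negbTE tF) expr0 scale1r; exact: cvg_at_right_filter.
Qed.

(** At a flip the sign [s] and the direction change together, so that their product f is continuous.
    The product of G with f is then the signed imaginary coordinate. *)
Lemma exists_unit_lift : exists f : R -> cd R n, [/\ continuous f,
  forall t, im_units (f t),
  forall t, t \notin ts -> f t = s t *: im_dir G t,
  forall t, cd_im (G t) = dot (G t) (f t) *: f t &
  forall t, dot (G t) (f t) = s t * cd_norm (cd_im (G t))].
Proof.
have [U [US Uim Ul Ur]] := exists_direction.
have sf2 t : s t * s t = 1 by exact: sign_mul_self.
have polar t : cd_im (G t) = cd_norm (cd_im (G t)) *: U t.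
  have [/tsP/is_realP Gt|tts] := boolP (t \in ts).
    by rewrite Gt cd_normE dot0l sqrtr0 scale0r.
  by rewrite Uim//; exact: cd_im_polar.
have dotE t : dot (G t) (s t *: U t) = s t * cd_norm (cd_im (G t)).
  have [U0 U1] := (im_unitsP _).1 (US t).
  rewrite [G t in LHS]cd_decomp dotZr dotDl dotZl [dot (cd_one R n) _]dotC dot_one U0 mulr0 add0r.
  by rewrite [cd_im (G t) in LHS]polar dotZl U1 mulr1.
exists (fun t => s t *: U t); split => //.
- move=> t; apply/left_right_continuousP; split.
    apply: (cvg_trans _ (cvgZ (cvg_cst (s t)) (Ul t))); apply: near_eq_cvg; near=> x.
    have -> : s x = s t by congr (_ ^+ _); near: x; exact: near_left_count.
    by rewrite Uim//; near: x; exact: near_left_notin.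
  have [cE _] := count_le_sorted t F_sorted.
  have -> : s t *: U t = (s t * (-1) ^+ (t \in F)) *: ((-1) ^+ (t \in F) *: U t).
    by rewrite scalerA -mulrA sign_mul_self mulr1.
  apply: (cvg_trans _ (cvgZ (cvg_cst _) (Ur t))); apply: near_eq_cvg; near=> x.
  have -> : s x = s t * (-1) ^+ (t \in F).
    rewrite -exprD; congr (_ ^+ _); rewrite -cE.
    by near: x; exact: near_right_count.
  by rewrite Uim//; near: x; exact: near_right_notin.
- move=> t; have [U0 U1] := (im_unitsP _).1 (US t); apply/im_unitsP.
  by rewrite cd_reZ U0 mulr0 dotZl dotZr U1 mulr1 sf2.
- by move=> t tts; rewrite Uim.
- by move=> t; rewrite dotE scalerA mulrAC sf2 mul1r; exact: polar.
Unshelve. all: by end_near. Qed.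

Let rho t := cd_norm (G t).
(* [alpha] is the angle of [x + i |Y|], in [[0, pi]]. The argument of the shadow
   [x + i s |Y|] is [s alpha], up to the multiple [C] of [2 pi] which keeps it
   continuous when [s] changes its sign. *)
Let alpha t : R := acos (clamp (-1) 1 (cd_re (G t) / rho t)).
Let C k : R := \sum_(l < k) 2 * (-1) ^+ l * alpha (nth 0 F l).

Lemma rho_gt0 t : 0 < rho t.
Proof. by rewrite /rho cd_norm_gt0. Qed.

Lemma ratio_itv t : cd_re (G t) / rho t \in `[-1, 1].
Proof.
rewrite in_itv /= -ler_norml normf_div (gtr0_norm (rho_gt0 t)).
rewrite ler_pdivrMr ?rho_gt0// mul1r -ler_sqr ?nnegrE ?(ltW (rho_gt0 t))//.
by rewrite real_normK ?num_real// /rho cd_norm_sqr dot_decomp lerDl sqr_ge0.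
Qed.

Lemma continuous_alpha : continuous alpha.
Proof.
move=> t; apply: (@continuous_comp _ _ _ (fun t => cd_re (G t) / rho t)
  (fun x => acos (clamp (-1) 1 x))); last exact: continuous_acos_clamp.
apply: cvgM; first by apply: (@continuous_comp _ _ _ G (@cd_re R n));
  [exact: Gc|exact: continuous_cd_re].
apply: cvgV; first by rewrite gt_eqF// rho_gt0.
by apply: (@continuous_comp _ _ _ G (@cd_norm R n)); [exact: Gc|exact: continuous_cd_norm].
Qed.

Lemma cos_alpha t : rho t * cos (alpha t) = cd_re (G t).
Proof.
by rewrite /alpha clamp_id ?acosK ?ratio_itv// mulrC divfK// gt_eqF// rho_gt0.
Qed.

Lemma sin_alpha t : rho t * sin (alpha t) = cd_norm (cd_im (G t)).
Proof.
have r0 := rho_gt0 t; have u1 := ratio_itv t.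
rewrite /alpha clamp_id// sin_acos; last by move: u1; rewrite in_itv.
have -> : 1 - (cd_re (G t) / rho t) ^+ 2 = (cd_norm (cd_im (G t)) / rho t) ^+ 2.
  have rho2 : rho t ^+ 2 = cd_re (G t) ^+ 2 + cd_norm (cd_im (G t)) ^+ 2.
    by rewrite -dot_decomp cd_norm_sqr.
  rewrite !exprMn -[1](divff (x := rho t ^+ 2)) ?expf_neq0 ?gt_eqF// exprVn.
  by rewrite -mulrBl; congr (_ * _); rewrite rho2 addrC addKr.
rewrite sqrtr_sqr ger0_norm; first by rewrite mulrC divfK// gt_eqF.
by rewrite divr_ge0 ?(ltW r0)// cd_normE sqrtr_ge0.
Qed.

(** At a flip G is a nonzero real, so the angle is 0 or pi. Writing it through [sgz] lets the jumps
    be summed to the signature. *)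
Lemma alpha_flip t : t \in F -> alpha t = pi * (1 - (sgz (cd_re (G t)))%:~R) / 2.
Proof.
move=> /F_flip[/tsP/is_realP Gt _].
have norm_re : rho t = `|cd_re (G t)|.
  by rewrite /rho cd_normE dot_decomp Gt cd_normE dot0l sqrtr0 expr0n addr0 sqrtr_sqr.
have re0 : cd_re (G t) != 0 by rewrite -normr_eq0 -norm_re gt_eqF// rho_gt0.
rewrite /alpha clamp_id ?ratio_itv// norm_re.
have [re_lt|re_gt|re_eq] := ltgtP (cd_re (G t)) 0; last by rewrite re_eq eqxx in re0.
  rewrite ltr0_norm// invrN mulrN divff// acosN1 ltr0_sgz// mulrN1z opprK.
  by rewrite -mulrA divff ?mulr1// (_ : 1 + 1 = 2)// pnatr_eq0.
by rewrite gtr0_norm// divff// acos1 gtr0_sgz// subrr mulr0 mul0r.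
Qed.

(** Each summand of [C k] is 0 or 2 pi up to sign, as the angle at a flip is 0 or pi. *)
Lemma cos_sin_turns k x : (k <= size F)%N -> cos (x + C k) = cos x /\ sin (x + C k) = sin x.
Proof.
elim: k => [_|k IH kF]; first by rewrite /C big_ord0 addr0.
have [IHc IHs] := IH (ltnW kF).
rewrite /C big_ord_recr /= -/(C k) addrA.
have alpha_k : alpha (nth 0 F k) = 0 \/ alpha (nth 0 F k) = pi.
  have kmem : nth 0 F k \in F by rewrite mem_nth.
  have re0 : cd_re (G (nth 0 F k)) != 0.
    have [/tsP/is_realP Gk _] := (F_flip _).1 kmem.
    apply: contra (G_neq0 (nth 0 F k)) => /eqP re0.
    by rewrite [G _]cd_decomp Gk re0 scale0r addr0.
  rewrite alpha_flip//; case: (ltgtP (cd_re (G (nth 0 F k))) 0) re0 => [re_lt|re_gt|->] _ //.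
    by right; rewrite ltr0_sgz// mulrN1z; field.
  by left; rewrite gtr0_sgz// subrr mulr0 mul0r.
have [ek|[ek|ek]] : 2 * (-1) ^+ k * alpha (nth 0 F k) = 0 \/
    (2 * (-1) ^+ k * alpha (nth 0 F k) = pi *+ 2 \/
     2 * (-1) ^+ k * alpha (nth 0 F k) = - (pi *+ 2)).
- case: alpha_k => ->; first by left; rewrite mulr0.
  right; rewrite -signr_odd -[pi *+ 2]mulr_natl; case: (odd k); [right|left].
    by rewrite expr1 mulrN1 mulNr.
  by rewrite expr0 mulr1.
- by rewrite ek addr0.
- by rewrite ek cosD2pi sinD2pi.
- have y : x + C k = (x + C k - pi *+ 2) + pi *+ 2 by rewrite subrK.
  by rewrite ek -cosD2pi -sinD2pi -y.
Qed.

Lemma exists_angle : exists theta : R -> R, [/\ continuous theta,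
  forall t, exists2 r : R, 0 < r & cd_re (G t) = r * cos (theta t) /\
    s t * cd_norm (cd_im (G t)) = r * sin (theta t) &
  forall a b, G a = G b -> (forall t, t \in F -> a < t < b) -> ~~ odd (size F) ->
    theta b - theta a =
    pi * (\sum_(l < size F) sgz (cd_re (G (nth 0 F l))) * (-1) ^+ l.+1)%:~R].
Proof.
have N_le t : (N t <= size F)%N by exact: count_size.
exists (fun t => s t * alpha t + C (N t)); split.
- move=> t; apply/left_right_continuousP; split.
    have Al : alpha x @[x --> t^'-] --> alpha t by apply: cvg_at_left_filter; exact: continuous_alpha.
    apply: (cvg_trans _ (cvgD (cvgM (cvg_cst (s t)) Al) (cvg_cst (C (N t))))).
    apply: near_eq_cvg; near=> x.
    have Nx : N x = N t by near: x; exact: near_left_count.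
    by rewrite /s Nx.
  have Ar : alpha x @[x --> t^'+] --> alpha t by apply: cvg_at_right_filter; exact: continuous_alpha.
  have [NE nthE] := count_le_sorted t F_sorted.
  (* At the flip of index k, passing from s to -s changes s alpha by -2 (-1)^k alpha, which is what
     the new summand of [C] restores. *)
  have -> : s t * alpha t + C (N t) =
      (-1) ^+ (N t + (t \in F)) * alpha t + C (N t + (t \in F))%N.
    case: (t \in F) nthE; last by rewrite addn0.
    move=> /(_ isT) nthE; rewrite addn1 /C big_ord_recr /= nthE exprS /s; ring.
  apply: (cvg_trans _ (cvgD (cvgM (cvg_cst _) Ar) (cvg_cst _))).
  apply: near_eq_cvg; near=> x.
  have Nx : N x = (N t + (t \in F))%N by rewrite -NE; near: x; exact: near_right_count.
  by rewrite /s Nx.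
- move=> t; exists (rho t); first exact: rho_gt0.
  have [-> ->] := cos_sin_turns (s t * alpha t) (N_le t).
  rewrite -sin_alpha -cos_alpha /s -signr_odd; case: (odd (N t)).
    by rewrite expr1 !mulN1r cosN sinN mulrN.
  by rewrite expr0 !mul1r.
- move=> a b Gab Fab evenF.
  have Na : N a = 0%N by apply: count_lt_none => t /Fab/andP[/ltW].
  have Nb : N b = size F by apply: count_lt_all => t /Fab/andP[].
  have Ab : alpha b = alpha a by rewrite /alpha /rho Gab.
  rewrite /s Na Nb -signr_odd (negbTE evenF) expr0 Ab /C big_ord0 addr0 addrAC subrr add0r.
  (* The summands of [C] are pi (-1)^l (1 - sign). The part without sign is an alternating sum of
     even length, hence 0, and the rest is pi times the signature. *)
  have sum0 : \sum_(l < size F) (-1) ^+ l = 0 :> R.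
    rewrite -(odd_double_half (size F)) (negbTE evenF) add0n.
    elim: (size F)./2 => [|k IH]; first by rewrite big_ord0.
    rewrite doubleS !big_ord_recr /= IH exprS; ring.
  rewrite -[LHS]subr0 -[X in _ - X = _](mulr0 pi) -[X in _ - pi * X = _]sum0.
  rewrite rmorph_sum /= !mulr_sumr -sumrB.
  apply: eq_bigr => l _; rewrite alpha_flip ?mem_nth// rmorphM rmorphXn /= rmorphN1 exprS.
  by field.
Unshelve. all: by end_near. Qed.

End Lifts.

(** * Parity of sums of signs, dependence on germs, paths of unit classes *)

Lemma even_sum_signs (e : nat -> int) (m : nat) :
  (forall l, (l < m)%N -> e l = 1 \/ e l = -1) ->
  (2 %| \sum_(l < m) e l)%Z = ~~ odd m.
Proof.
move=> e1; suff [q ->] : exists q : int, \sum_(l < m) e l = 2 * q + m%:Z.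
  by rewrite rpredDl ?dvdz_mulr// dvdzE dvdn2.
elim: m e1 => [|m IH] e1; first by exists 0; rewrite big_ord0.
have [q qE] := IH (fun l lm => e1 l (ltnW lm)); rewrite big_ord_recr /= qE.
have [->|->] := e1 m (ltnSn m); first by exists q; lia.
by exists (q - 1); lia.
Qed.

Section UnitPaths.
Context {R : realType} {n : nat}.
Implicit Types (g h : R -> cd R n) (t : R).

(** The one-sided limits depend only on the germ at [t], so flips transfer between a path and its
    extension to the line. *)
Lemma flip_near g h t : (\forall x \near t, g x = h x) -> flip g t -> flip h t.
Proof.
move=> gh [I IS [Il Ir]]; exists I => //.
have ghd : \forall x \near t, im_dir g x = im_dir h x.
  by apply: filterS gh => x; rewrite /im_dir => ->.
split.
  by apply: cvg_trans Il; apply: near_eq_cvg; apply: cvg_within; exact: ghd.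
by apply: cvg_trans Ir; apply: near_eq_cvg; apply: cvg_within; exact: ghd.
Qed.

Lemma bounce_near g h t : (\forall x \near t, g x = h x) -> bounce g t -> bounce h t.
Proof.
move=> gh [I IS [Il Ir]]; exists I => //.
have ghd : \forall x \near t, im_dir g x = im_dir h x.
  by apply: filterS gh => x; rewrite /im_dir => ->.
split.
  by apply: cvg_trans Il; apply: near_eq_cvg; apply: cvg_within; exact: ghd.
by apply: cvg_trans Ir; apply: near_eq_cvg; apply: cvg_within; exact: ghd.
Qed.

Definition to_unit (p : cd R n) (pS : im_units p) : @im_units R n :=
  exist _ p (mem_set pS).

Lemma continuous_to_unit (T : topologicalType) (f : T -> cd R n)
    (fS : forall u, im_units (f u)) :
  continuous f -> continuous (fun u => to_unit (fS u)).
Proof. by move=> fc; apply: continuous_comp_initial. Qed.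

Lemma continuous_unit_class (T : topologicalType) (I : T -> @im_units R n) :
  continuous I -> continuous (fun u => unit_class (I u)).
Proof.
move=> Ic u; apply: (@continuous_comp _ _ _ I (@unit_class R n)); first exact: Ic.
exact: pi_continuous.
Qed.

End UnitPaths.

(** * Signature, untwistedness and winding number *)

Theorem corollary5p10 (R : realType) (n : nat) (hn : n = 2%N \/ n = 3%N)
  (a b : R) (hab : a < b) (g : R -> cd R n)
  (g_neq0 : forall t, t \in `[a, b] -> g t != 0)
  (g_tame : tame_path a b g)
  (ts : seq R) (ts_sorted : sorted <%R ts)
  (tsE : [set t | t \in `[a, b] /\ is_real (g t)] = [set` ts])
  (ts_tame : forall t, t \in ts -> t \in `]a, b[ -> tame_param g t)
  (k0 : int)
  (g_lift : forall t1, ohead ts = Some t1 ->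
     exists G, [/\ is_lift a t1 g G,
                   forall t, t \in `[a, t1[ -> (G t).2 = Arg k0 (g t)
                 & Arg k0 (g t) @[t --> t1^'-] --> (G t1).2])
  (gab : g a = g b) (ga_nreal : ~ is_real (g a)) :
  ((2 %| signature a b g)%Z <-> (tame_loop a b g /\ untwisted a b g)) /\
  ((2 %| signature a b g)%Z ->
     is_wind a b g (`|signature a b g|%:~R / 2)).
Proof.
have [g_path [J1 [_ J1_uniq]]] := g_tame.
have leab := ltW hab.
have aab : a \in `[a, b] by rewrite in_itv /= lexx leab.
have bab : b \in `[a, b] by rewrite in_itv /= lexx leab.
pose G := g \o clamp a b.
have GE t : t \in `[a, b] -> G t = g t by move=> tab; rewrite /G /= clamp_id.
have Gc : continuous G by exact: continuous_comp_clamp.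
have G_neq0 t : G t != 0 by apply: g_neq0; exact: clamp_itv.
have tsP' t : t \in ts <-> t \in `[a, b] /\ is_real (g t).
  by have /(congr1 (fun A : set R => A t)) /= -> := tsE.
have tsP t : is_real (G t) <-> t \in ts.
  split=> [|/tsP'[tab]]; last by rewrite GE.
  rewrite tsP' /G /= => Gt; suff tab : t \in `[a, b] by move: Gt; rewrite clamp_id.
  (* Outside of [a, b] the extension takes the value g a = g b, which is not real, so it creates no
     new real parameters. *)
  rewrite in_itv /=; apply/andP; split; rewrite leNgt; apply/negP => tlt; apply: ga_nreal.
    by move: Gt; rewrite /clamp min_r ?max_l// ltW// (lt_trans tlt).
  by move: Gt; rewrite /clamp min_l ?max_r ?gab// ltW.
have ts_oo t : t \in ts -> t \in `]a, b[.
  move=> /tsP'[]; rewrite !in_itv /= => /andP[at_ tb] gt.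
  rewrite !lt_neqAle at_ tb !andbT; apply/andP; split; apply/eqP => E; apply: ga_nreal.
    by rewrite E.
  by rewrite gab -E.
have Gg_near t : t \in `]a, b[ -> \forall x \near t, G x = g x.
  move=> tab; have : \forall x \near t, x \in `]a, b[ by exact: near_in_itvoo tab.
  by apply: filterS => x xab; rewrite GE// (subset_itv_oo_cc xab).
have gG_near t : t \in `]a, b[ -> \forall x \near t, g x = G x.
  by move=> /Gg_near; apply: filterS.
have G_tame t : t \in ts -> tame_param G t.
  move=> tts; have tab := ts_oo _ tts; have [tb|tf] := ts_tame t tts tab.
    by left; exact: bounce_near (gG_near _ tab) tb.
  by right; exact: flip_near (gG_near _ tab) tf.
pose F := sort <=%O (fset_set (flips a b g)).
have F_sorted : sorted <%R F by rewrite sort_lt_sorted fset_uniq.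
have flips_fin : finite_set (flips a b g).
  apply: sub_finite_set (finite_seq ts) => t [tab gt _] /=; apply/tsP'; split=> //.
  exact: subset_itv_oo_cc tab.
have F_flip t : t \in F <-> t \in ts /\ flip G t.
  rewrite mem_sort in_fset_set// inE /flips /=; split=> [[tab gt tf]|[tts tf]].
    split; first by apply/tsP'; split=> //; exact: subset_itv_oo_cc tab.
    exact: flip_near (gG_near _ tab) tf.
  have tab := ts_oo _ tts; have [_ gt] := (tsP' t).1 tts.
  by split=> //; exact: flip_near (Gg_near _ tab) tf.
have F_ab t : t \in F -> a < t < b.
  by move=> /F_flip[/ts_oo]; rewrite in_itv.
have [f [fc fS f_dir f_im f_dot]] := exists_unit_lift Gc tsP G_tame F_sorted F_flip.
have [theta [theta_c theta_polar theta_ab]] := exists_angle Gc G_neq0 tsP F_sorted F_flip.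
have f1 t : dot (f t) (f t) = 1 by have [] := (im_unitsP _).1 (fS t).
have Gab : G a = G b by rewrite !GE.
(* The ends are not real, so there f is the direction times the sign, and all the flips lie strictly
   between them. *)
have f_b : f b = (-1) ^+ size F *: f a.
  have nts c : c = a \/ c = b -> c \notin ts.
    by move=> cE; apply/negP => /ts_oo; case: cE => ->; rewrite in_itv /= ltxx ?andbF.
  rewrite !f_dir; [|exact: nts (or_introl _)|exact: nts (or_intror _)].
  rewrite (count_lt_all (fun t tF => proj2 (andP (F_ab t tF)))).
  rewrite (count_lt_none (fun t tF => ltW (proj1 (andP (F_ab t tF))))).
  by rewrite expr0 scale1r /im_dir Gab.
pose I t := to_unit (fS t).
pose J t := unit_class (I t).
have GI t : G t = cd_re (G t) *: cd_one R n + dot (G t) (f t) *: f t.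
  by rewrite -f_im -cd_decomp.
have J_comp : companion a b g J.
  split; first by apply: continuous_is_path; exact/continuous_unit_class/continuous_to_unit.
  move=> t tab; exists (I t); split=> //.
  by exists (cd_re (G t)), (dot (G t) (f t)); rewrite -GE//; exact: GI.
have J_uniq : unique_companion a b g J.
  by split=> // J' J'c t tab; rewrite (J1_uniq _ J'c)// (J1_uniq _ J_comp).
(* The ends of f agree up to sign, so the companion closes for either parity of the number of flips.
   The parity decides whether f itself closes. *)
have tameJ : tame_loop a b g.
  do 2 split=> //; exists J; split=> //; apply/unit_classE; rewrite /= f_b.
  rewrite -signr_odd; case: (odd _); [right|left]; first by rewrite expr1 scaleN1r opprK.
  by rewrite expr0 scale1r.
have sigE : signature a b g =
    \sum_(l < size F) sgz (cd_re (G (nth 0 F l))) * (-1) ^+ l.+1.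
  rewrite /signature -/F; apply: eq_bigr => l _; rewrite GE//.
  have /F_ab/andP[al lb] : nth 0 F l \in F by rewrite mem_nth.
  by rewrite in_itv /= !ltW.
have sig_even : (2 %| signature a b g)%Z = ~~ odd (size F).
  rewrite sigE; apply: (even_sum_signs (e := fun l => sgz (cd_re (G (nth 0 F l))) * (-1) ^+ l.+1)).
  move=> l lF; have /F_flip[/tsP/is_realP Gl _] : nth 0 F l \in F by rewrite mem_nth.
  have re0 : cd_re (G (nth 0 F l)) != 0.
    apply: contra (G_neq0 (nth 0 F l)) => /eqP re0.
    by rewrite [G _]cd_decomp Gl re0 scale0r addr0.
  rewrite -signr_odd; case: (ltgtP (cd_re (G (nth 0 F l))) 0) re0 => [l0|l0|->]; rewrite ?eqxx// => _.
    by rewrite ltr0_sgz//; case: (odd _); [left|right].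
  by rewrite gtr0_sgz//; case: (odd _); [right|left].
split.
  rewrite sig_even; split=> [evenF|[_ [_ [J' [J'_uniq [c J'c]]]]]].
    split=> //; split=> //; exists J; split=> //.
    have fba : f a = f b by rewrite f_b -signr_odd (negbTE evenF) expr0 scale1r.
    have [H [Hc HS H0 H1 Hs]] := sphere_loop_nullhomotopic hn hab fc fS fba.
    exists (J a), (fun p => unit_class (to_unit (HS p))); split.
    - by apply: continuous_subspaceT; exact/continuous_unit_class/continuous_to_unit.
    - by move=> t tab; apply/unit_classE; left; exact: H0.
    - by move=> t tab; apply/unit_classE; left; exact: H1.
    - move=> s _; have [Ha Hb] := Hs s.
      by split; apply/unit_classE; left; rewrite /= ?Ha ?Hb.
  (* By uniqueness the null-homotopic companion is the class of f, a path with antipodal ends. *)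
  apply/negP => oddF.
  have f_ba : f b = - f a by rewrite f_b -signr_odd oddF expr1 scaleN1r.
  apply: (@antipodal_path_not_nullhomotopic R n a b f I c) => //.
  have JJ' t : t \in `[a, b] -> J t = J' t by move=> tab; rewrite (J'_uniq.2 _ J_comp).
  have [H [Hc H0 H1 Hs]] := J'c; exists H; split=> //.
    by move=> t tab; rewrite H0// -JJ'.
  by move=> s s01; rewrite -![unit_class _]/(J _) !JJ'//; exact: Hs.
rewrite sig_even => evenF; split.
  exists (fun t => (cd_re (G t) +i* dot (G t) (f t))%C).
  exists J, I, (fun t => cd_re (G t)), (fun t => dot (G t) (f t)); split=> //.
  - split=> //; apply: continuous_is_path.
    exact: continuous_to_unit.
  - split; apply: continuous_is_path; last exact: continuous_dot.
    by move=> t; apply: (@continuous_comp _ _ _ G (@cd_re R n)); [exact: Gc|exact: continuous_cd_re].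
  - by move=> t tab; rewrite -GE//; exact: GI.
move=> z [J' [I' [x [y [J'_uniq [I'c I'J'] [xc yc] gE zE]]]]].
have I'f t : t \in `[a, b] -> val (I' t) = f t \/ val (I' t) = - f t.
  move=> tab; apply/(unit_classE (I' t) (I t)).
  by rewrite I'J'// (J1_uniq _ J'_uniq.1)// -(J1_uniq _ J_comp).
(* The sign between the lift [I'] of an arbitrary shadow and f. It is continuous, hence constant, so
   the shadow is the one built from f or its conjugate. *)
pose k t := dot (val (I' t)) (f t).
have k_path : is_path a b k.
  apply/subspace_continuousP => t tab; apply: cvg_dot.
    apply: cvg_comp ((subspace_continuousP _ _).1 I'c t tab) _.
    exact: continuous_im_units_val.
  by apply: cvg_within_filter; exact: fc.
have k1 t : t \in `[a, b] -> k t = 1 \/ k t = -1.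
  by move=> tab; rewrite /k; case: (I'f t tab) => ->; rewrite ?dotNl f1; [left|right].
have kE := sign_constant leab k_path k1.
have I'E t : t \in `[a, b] -> val (I' t) = k a *: f t.
  move=> tab; rewrite -(kE t tab) /k.
  by case: (I'f t tab) => ->; rewrite ?dotNl f1 ?scaleN1r ?scale1r.
have xyE t : t \in `[a, b] -> x t = cd_re (G t) /\ y t = k a * dot (G t) (f t).
  move=> tab; have [I0 I1] := (im_unitsP _).1 (im_units_val (I' t)).
  rewrite -dotZr -I'E// GE// gE// cd_reD !cd_reZ cd_re1 I0 mulr0 addr0 mulr1; split=> //.
  by rewrite dotDl !dotZl I1 [dot (cd_one R n) _]dotC dot_one I0 mulr0 add0r mulr1.
have fba : f b = f a by rewrite f_b -signr_odd (negbTE evenF) expr0 scale1r.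
have [q sq] : exists q : int, signature a b g = q * 2.
  by apply/dvdzP; rewrite sig_even.
have kint : exists2 c : int, k a = c%:~R & `|c| = 1.
  by case: (k1 a aab) => ->; [exists 1|exists (-1)]; rewrite // mulrN1z.
have [c kc c1] := kint.
(* The signature is 2 q, and [theta] varies by pi times it, that is by 2 pi q. Conjugating the
   shadow multiplies the argument by [c], which is 1 or -1. *)
exists (c * q); split; last first.
  rewrite sq !normrM c1 mul1r (_ : `|2| = 2 :> int)// intrM mulfK//.
  by rewrite intr_eq0.
split; first by rewrite !zE// !(xyE _ _).1// !(xyE _ _).2// Gab fba.
exists (fun t => k a * theta t); split.
- apply: continuous_is_path => t.
  by apply: cvgM; [exact: cvg_cst|exact: theta_c].
- move=> t tab; have [r r0 [re_r im_r]] := theta_polar t; exists r => //.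
  have [xt yt] := xyE t tab; rewrite zE// xt yt f_dot re_r im_r.
  by case: (k1 a aab) => ->; rewrite ?mulN1r ?mul1r ?cosN ?sinN ?mulrN.
- rewrite -mulrBr theta_ab// -sigE sq kc !intrM; ring.
Qed.
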